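(* In the Gaussian sequence model $Y_j=\theta_j^0+\frac1{\sqrt n}\xi_j$, $j\ge1$, suppose that $\theta^0$ belongs to the Sobolev class of regularity $\alpha>0$, i.e. $\sum_{j=1}^\infty|\theta_j^0|^2j^{2\alpha}<\infty$. Choose a prior $\widetilde W=\mathcal{N}(0,\tau_n^2I_{k_n})$ on $\theta\in\mathbb{R}^{k_n}$ with $\tau_n>0$ such that $n^{-1/4}=o(\tau_n)$. This ensures the asymptotic normality of the posterior distribution, $$E\left\|\widetilde W(d\theta\mid Y)-\mathcal{N}\left(\theta_Y,\tfrac1nI_{k_n}\right)\right\|_{\mathrm{TV}}\longrightarrow0\qquad\text{as }n\to\infty .$$ If further $k_n\approx n^{1/(1+2\alpha)}$, then the convergence rate of $\theta$ toward $\theta_0$ and toward $\theta^0$ is $n^{-\alpha/(1+2\alpha)}$: for every sequence $\lambda_n\to\infty$, $$E\left[\widetilde W\left(\|\theta-\theta_0\|\ge\lambda_nn^{-\alpha/(1+2\alpha)}\mid Y\right)\right]\longrightarrow0\quad\text{and}\quad E\left[\widetilde W\left(\|\theta-\theta^0\|\ge\lambda_nn^{-\alpha/(1+2\alpha)}\mid Y\right)\right]\longrightarrow0 .$$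
   Context: Gaussian sequence model: for each $n\ge1$ one observes $Y_j=\theta_j^0+n^{-1/2}\xi_j$, $j\ge1$, where $\xi_1,\xi_2,\dots$ are independent $\mathcal{N}(0,1)$ and $\theta^0=(\theta^0_j)_{j\ge1}$ is the true parameter, not depending on $n$; $E$ is expectation under this true distribution. For integers $1\le k_n\le n$ one uses the first $k_n$ coordinates: $\theta_0=(\theta_j^0)_{1\le j\le k_n}$ and $\theta_Y=(Y_j)_{1\le j\le k_n}$. $\widetilde W(d\theta\mid Y)$ is the posterior distribution of $\theta\in\mathbb{R}^{k_n}$ when $\theta\sim\widetilde W$ and, conditionally on $\theta$, $(Y_j)_{1\le j\le k_n}\sim\mathcal{N}(\theta,\frac1nI_{k_n})$. Vectors $\theta,\theta_0\in\mathbb{R}^{k_n}$ are viewed as elements of $\ell^2(\mathbb{N})$ by completing them with zeros, and $\|\cdot\|$ is the $\ell^2$ norm. $a_n\approx b_n$ means that $a_n/b_n$ is bounded above and below by positive constants. $\|Q-Q'\|_{\mathrm{TV}}=\sup_A|Q(A)-Q'(A)|$. *)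

(* Defs.v *)
From HB Require Import structures.
From mathcomp Require Import all_boot all_order all_algebra.
From mathcomp Require Import all_classical all_reals all_analysis.
Set Implicit Arguments.
Unset Strict Implicit.
Unset Printing Implicit Defensive.
Import Order.TTheory GRing.Theory Num.Theory.
Import numFieldNormedType.Exports.
Local Open Scope classical_set_scope.
Local Open Scope ring_scope.

Section tuple_cons_measurable.
Context d (T : measurableType d) (n : nat).

Definition tuple_cons (x : T * n.-tuple T) : n.+1.-tuple T :=
  [tuple of x.1 :: x.2].

Lemma measurable_tuple_cons : measurable_fun [set: T * n.-tuple T] tuple_cons.
Proof. exact: measurable_cons. Qed.

HB.instance Definition _ :=
  isMeasurableFun.Build _ _ _ _ tuple_cons measurable_tuple_cons.

End tuple_cons_measurable.

(* Product P_0 x ... x P_(n-1) of probability measures, on the product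
   sigma-algebra of n.-tuple T. *)
Fixpoint prod_prob d (T : measurableType d) (R : realType) (n : nat) :
    ('I_n -> probability T R) -> probability (n.-tuple T) R :=
  match n with
  | 0%N => fun _ => \d_ ([tuple] : 0.-tuple T)
  | m.+1 => fun P =>
      distribution (P ord0 \x prod_prob (fun i => P (lift ord0 i)))%E
                   (@tuple_cons _ T m)
  end.

Lemma prod_prob_box d (T : measurableType d) (R : realType) (n : nat)
    (P : 'I_n -> probability T R) (A : 'I_n -> set T) :
  (forall i, measurable (A i)) ->
  prod_prob P [set x | forall i, A i (tnth x i)] = (\prod_(i < n) P i (A i))%E.
Proof.
elim: n P A => [|n IH] P A mA.
  rewrite big_ord0 /= /dirac indicE mem_set//= => -[m m0].
  by have := m0; rewrite ltn0.
have mB m (B : 'I_m -> set T) : (forall i, measurable (B i)) ->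
    measurable [set x : m.-tuple T | forall i, B i (tnth x i)].
  move=> mB; rewrite (_ : [set _ | _] =
      \big[setI/setT]_(i < m) ((@tnth m T ^~ i) @^-1` B i)).
    apply: bigsetI_measurable => i _; rewrite -[X in measurable X]setTI.
    exact: measurable_tnth.
  rewrite -bigcap_seq; apply/seteqP; split => [x Bx i _|x Bx i]; first exact: Bx.
  by apply: Bx; rewrite /= mem_index_enum.
rewrite big_ord_recl -IH// /= /distribution /pushforward /=.
rewrite (_ : _ @^-1` _ = A ord0 `*`
    [set x : n.-tuple T | forall i : 'I_n, A (lift ord0 i) (tnth x i)]).
  have mBn := mB n (fun i => A (lift ord0 i)) (fun i => mA _).
  by rewrite product_measure1E.
apply/seteqP; split => -[x t] /=.
  move=> Axt; split=> [|i]; first exact: (Axt ord0).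
  by have := Axt (lift ord0 i); rewrite (tnthS x t).
move=> [Ax At] i; case: (unliftP ord0 i) => [l|] ->; last exact: Ax.
by rewrite /tuple_cons/= (tnthS x t); exact: At.
Qed.

Section normal_law.
Context (R : realType).

Let idTR : measurableTypeR R -> R := idfun.

Let measurable_idTR : measurable_fun [set: measurableTypeR R] idTR.
Proof. by move=> _ A mA; rewrite setTI. Qed.

HB.instance Definition _ :=
  isMeasurableFun.Build _ _ _ _ idTR measurable_idTR.

(* [normal_prob m s] lives on [measurableTypeR R]; this is the same set
   function, transported to the canonical measurable type of [R]. *)
Definition normal_law (m s : R) : probability R R :=
  distribution (normal_prob m s : probability (measurableTypeR R) R)
               (idTR : {mfun measurableTypeR R >-> R}).

Lemma normal_lawE (m s : R) (A : set R) :
  normal_law m s A = normal_prob m s A.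
Proof. by []. Qed.

End normal_law.

(* The law N(m, s^2 I_k): [s] is the standard deviation. *)
Definition gaussian (R : realType) (k : nat) (m : k.-tuple R) (s : R) :
    probability (k.-tuple R) R :=
  prod_prob (fun i => normal_law (tnth m i) s).

Definition mutually_independent d (T : measurableType d) (R : realType)
    (P : probability T R) (X : nat -> {RV P >-> R}) : Prop :=
  forall (J : seq nat) (A : nat -> set R), uniq J ->
    (forall j, measurable (A j)) ->
    P (\bigcap_(j in [set` J]) (X j @^-1` A j)) =
    (\prod_(j <- J) P (X j @^-1` A j))%E.

(* [post] is a version of the conditional distribution of theta given Y, when
   theta has law [W] and, conditionally on theta, Y has law [lik theta]: both
   sides are the probability that theta is in A and Y is in B. *)
Definition is_posterior d d' (Th : measurableType d) (Y : measurableType d')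
    (R : realType) (W : probability Th R) (lik : Th -> probability Y R)
    (post : R.-pker Y ~> Th) : Prop :=
  forall (A : set Th) (B : set Y), measurable A -> measurable B ->
    (\int[W]_(t in A) lik t B = \int[W]_t \int[lik t]_(y in B) post y A)%E.

Definition dTV d (T : measurableType d) (R : realType)
    (Q Q' : set T -> \bar R) : \bar R :=
  ereal_sup [set `|Q A - Q' A|%E | A in (measurable : set (set T))].

Definition l2norm (R : realType) (u : nat -> R) : \bar R :=
  ('N[counting]_(2%:E) [EFin \o u])%E.

(* Norm of t - u in l^2, the vector t being completed with zeros. *)
Definition l2dist (R : realType) (k : nat) (t : k.-tuple R) (u : nat -> R) :=
  l2norm (fun j => nth 0 t j - u j).

(* Sequences indexed by j >= 1 in the mathematics are indexed from 0 here, so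
   the weight of the entry [u j] is (j + 1)^(2 a). *)
Definition sobolev (R : realType) (a : R) (u : nat -> R) : Prop :=
  cvgn (series (fun j => `|u j| ^+ 2 * j.+1%:R `^ (2 * a))).

Definition truncation (R : realType) (k : nat) (u : nat -> R) : k.-tuple R :=
  [tuple u i | i < k].

(* Y_j = theta0_j + n^(-1/2) xi_j for the first k indices j. *)
Definition obs (R : realType) (n k : nat) (theta0 xi : nat -> R) : k.-tuple R :=
  truncation k (fun j => theta0 j + (Num.sqrt n%:R)^-1 * xi j).

Definition same_order (R : realType) (a b : nat -> R) : Prop :=
  exists c C : R, [/\ 0 < c, 0 < C &
    forall n, (0 < n)%N -> c <= a n / b n <= C].

(* Main.v *)
Require Import Defs.
From HB Require Import structures.
From mathcomp Require Import all_boot all_order all_algebra.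
From mathcomp Require Import all_classical all_reals all_analysis.
From mathcomp Require Import measurable_realfun.
From mathcomp Require Import ring lra.
Set Implicit Arguments.
Unset Strict Implicit.
Unset Printing Implicit Defensive.
Import Order.TTheory GRing.Theory Num.Theory.
Import numFieldNormedType.Exports.
Local Open Scope classical_set_scope.
Local Open Scope ring_scope.

(* Normal priors are conjugate: with sigma^2 = 1/n, M^2 = sigma^2 + tau^2 and
   e = sigma^2 / M^2, the posterior given Y = y is N((1 - e) y, s^2 I_k) with
   s^2 = (1 - e) sigma^2, for almost every y.  The kernel [post] is only known
   up to null sets of the marginal law N(0, M^2 I_k) of y, and the law of Y at
   the true parameter is absolutely continuous with respect to it.

   The chi-square distance of N((1 - e) y, s^2 I_k) to N(y, sigma^2 I_k) is at
   most exp Z - 1 with Z = k e^2 + e^2 |y|^2 / sigma^2, and E Z is of order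
   n e^2 <= 1 / (n tau^4), which tends to 0 because n^(-1/4) = o(tau).

   For the rate, the expected posterior second moment of |theta - theta_0| is of
   order k / n + e^2 |theta^0|^2, hence of order k / n, and truncation costs
   k^(-2 alpha); both are of order n^(-2 alpha / (1 + 2 alpha)), so that
   Markov's inequality concludes. *)

(** Any version of the posterior is allowed, and its defining identity controls [post y A] only off
    a null set that may depend on [A], whereas the total variation distance takes a supremum over
    all [A]. Products of rays with rational endpoints form a countable family, stable under
    intersection, that determines a law on tuples, so one null set serves every [A]. That supremum
    also comes without measurability in the sample point; the expected distance is therefore bounded
    as a lower integral.

    Bayes' formula rests on a symmetry: a single likelihood ratio is both the density of the
    observation given theta with respect to its marginal law and the density of the posterior with
    respect to the prior.

    The total variation bound is kept linear in the chi-square distance, with a free delta, rather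
    than as its square root, and exp Z - 1 is in turn replaced by a multiple of Z. Averaging over
    the observations then involves only second moments, for which crude constants are enough. *)

(** * Integration against a measure with a density *)

Section density.
Local Open Scope ereal_scope.
Context d (T : measurableType d) (R : realType).
Variables (mu nu : {measure set T -> \bar R}) (g : T -> R).
Hypotheses (mg : measurable_fun setT g) (g0 : forall x, (0 <= g x)%R).
Hypothesis nuE : forall A, measurable A -> nu A = \int[mu]_(x in A) (g x)%:E.

Import HBNNSimple.

Lemma integral_density_nnsfun (h : {nnsfun T >-> R}) :
  \int[nu]_x (h x)%:E = \int[mu]_x ((h x)%:E * (g x)%:E).
Proof.
have mind r : measurable_fun setT ((fun x => (r * \1_(h @^-1` [set r]) x)%:E) : T -> \bar R).
  by apply/measurable_EFinP/measurable_funM.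
transitivity (\int[nu]_x
   (\sum_(y \in range h) (y * \1_(h @^-1` [set y]) x)%:E)).
  by apply: eq_integral => t tE; rewrite /= fimfunE -fsumEFin.
rewrite ge0_integral_fsum//; last by move=> m y Ey; exact: nnfun_muleindic_ge0.
transitivity (\int[mu]_x (\sum_(y \in range h)
    ((y * \1_(h @^-1` [set y]) x)%:E * (g x)%:E))); last first.
  apply: eq_integral => x _; rewrite -ge0_mule_fsuml => [|y]; last exact: nnfun_muleindic_ge0.
  by rewrite fsumEFin // -(fimfunE _ x).
rewrite ge0_integral_fsum//; last 2 first.
  - by move=> y; apply: emeasurable_funM => //; exact/measurable_EFinP.
  - by move=> m y Ey; rewrite mule_ge0 ?lee_fin// -lee_fin nnfun_muleindic_ge0.
apply: eq_fsbigr => r rhn.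
under eq_integral do rewrite EFinM.
rewrite integralZl_indic_nnsfun//.
have [r0|r0] := ltP r 0%R.
  have -> : h @^-1` [set r] = set0 by rewrite preimage_nnfun0.
  under [RHS]eq_integral do rewrite indic0 mulr0 mul0e.
  rewrite integral0.
  under eq_integral do rewrite indic0.
  by rewrite integral0 mule0.
under [RHS]eq_integral do rewrite EFinM -muleA.
rewrite ge0_integralZl//; last 2 first.
  - by apply: emeasurable_funM; exact/measurable_EFinP.
  - by move=> x _; rewrite mule_ge0 ?lee_fin.
congr (_ * _); rewrite integral_indic// setIT nuE//.
rewrite integral_mkcond; apply: eq_integral => x _.
rewrite patchE indicE.
by case: ifPn => _; rewrite /= ?mul1e ?mul0e.
Qed.

(** Monotone convergence from simple functions. The density is an explicit function characterised by
    its integrals over sets, so that Lebesgue densities and likelihood ratios between laws are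
    treated alike. *)
Lemma ge0_integral_density (f : T -> \bar R) : measurable_fun setT f ->
  (forall x, 0 <= f x) -> \int[nu]_x f x = \int[mu]_x (f x * (g x)%:E).
Proof.
move=> mf f0; pose h := nnsfun_approx measurableT mf.
have fE x : f x = lim ((EFin \o h n) x @[n --> \oo]).
  by apply/esym/cvg_lim => //; exact: cvg_nnsfun_approx.
have -> : \int[nu]_x f x = lim (\int[nu]_x (EFin \o h n) x @[n --> \oo]).
  under eq_integral => x _ do rewrite fE.
  apply: monotone_convergence => //.
  - by move=> n; apply/measurable_EFinP.
  - by move=> n x Ex //=; rewrite lee_fin.
  - by move=> x Ex a b ab; rewrite lee_fin; exact/lefP/nd_nnsfun_approx.
have -> : \int[mu]_x (f x * (g x)%:E) =
    lim (\int[mu]_x ((h n x)%:E * (g x)%:E) @[n --> \oo]).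
  have fg x : f x * (g x)%:E = lim (((EFin \o h n) x * (g x)%:E) @[n --> \oo]).
    by apply/esym/cvg_lim => //; apply: cvgeZr => //; exact: cvg_nnsfun_approx.
  under eq_integral => x _ do rewrite fg.
  apply: monotone_convergence => [//| | |].
  - by move=> n; apply/emeasurable_funM; exact/measurable_EFinP.
  - by move=> n x _; rewrite mule_ge0 ?lee_fin.
  - by move=> x _ a b ab; rewrite lee_wpmul2r ?lee_fin//; exact/lefP/nd_nnsfun_approx.
by under eq_fun do rewrite integral_density_nnsfun.
Qed.

End density.

(** * Comparison of integrals with a non-measurable smaller function *)

Section lower_integral.
Local Open Scope ereal_scope.
Context d (T : measurableType d) (R : realType).
Variable mu : {measure set T -> \bar R}.

Import HBNNSimple.

(* The integral of a nonnegative function is a supremum over the simple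
   functions below it, so the smaller function need not be measurable. *)
Lemma ae_ge0_le_lower_integral (f g : T -> \bar R) :
  (forall x, 0 <= f x) -> (forall x, 0 <= g x) -> measurable_fun setT g ->
  {ae mu, forall x, f x <= g x} -> \int[mu]_x f x <= \int[mu]_x g x.
Proof.
move=> f0 g0 mg fg; rewrite ge0_integralTE//.
apply: ge_ereal_sup => _ [h /= hf <-].
have -> : sintegral mu h = \int[mu]_x (h x)%:E.
  rewrite integral_nnsfun//; congr sintegral.
  by apply/funext => x; rewrite patch_setT.
apply: ae_ge0_le_integral => //.
- by move=> x _; rewrite lee_fin.
- exact/measurable_EFinP.
- by apply: filterS fg => x fgx _; exact: le_trans (hf x) fgx.
Qed.

End lower_integral.

Lemma integral_prob_cst d (T : measurableType d) (R : realType)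
  (Q : probability T R) (r : R) : (\int[Q]_x r%:E = r%:E)%E.
Proof.
rewrite integral_cst// -[RHS]mule1.
by congr (_ * _)%E; exact: probability_setT.
Qed.

(** * Total variation and chi-square distance *)

Section total_variation.
Local Open Scope ereal_scope.
Context d (T : measurableType d) (R : realType).

Lemma dTV_le1 (Q Q' : probability T R) : dTV Q Q' <= 1.
Proof.
apply: ge_ereal_sup => _ [A mA <-].
have p (P : probability T R) : exists2 x, P A = x%:E & (0 <= x <= 1)%R.
  have PA : P A \is a fin_num by rewrite fin_num_measure.
  exists (fine (P A)); first by rewrite fineK.
  by rewrite -!lee_fin fineK// measure_ge0 probability_le1.
have [x -> /andP[x0 x1]] := p Q; have [y -> /andP[y0 y1]] := p Q'.
by rewrite -EFinB lee_fin ler_norml; apply/andP; split; lra.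
Qed.

Variables (Q Q' : probability T R) (f : T -> R) (v delta : R).
Hypotheses (mf : measurable_fun setT f) (f0 : forall x, (0 <= f x)%R).
Hypothesis QE : forall A, measurable A -> Q A = \int[Q']_(x in A) (f x)%:E.
Hypothesis fv : \int[Q']_x ((f x) ^+ 2)%:E <= (1 + v)%:E.
Hypothesis delta_gt0 : (0 < delta)%R.

Let h x : R := (delta + (f x - 1) ^+ 2 / delta)%R.

Let h0 x : (0 <= h x)%R.
Proof.
apply: addr_ge0; first exact: ltW.
by rewrite mulr_ge0 ?sqr_ge0// invr_ge0 ltW.
Qed.

Let mh : measurable_fun setT h.
Proof.
apply: measurable_funD => //; apply: measurable_funM => //.
by apply: measurable_funX; exact: measurable_funB.
Qed.

Let int_sqr : \int[Q']_x ((f x - 1) ^+ 2)%:E <= v%:E.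
Proof.
have mg : measurable_fun setT (fun x => ((f x - 1) ^+ 2)%R).
  by apply: measurable_funX; exact: measurable_funB.
(* Integrating (f - 1)^2 + 2 f = f^2 + 1 in this form avoids subtracting extended reals; the term 2
   is twice the total mass of [Q]. *)
have e : \int[Q']_x ((f x - 1) ^+ 2)%:E + 2%:E = \int[Q']_x ((f x) ^+ 2)%:E + 1.
  transitivity (\int[Q']_x (((f x - 1) ^+ 2)%:E + (2 * f x)%:E)).
    rewrite ge0_integralD//=; last 4 first.
    - by move=> x _; rewrite lee_fin sqr_ge0.
    - exact/measurable_EFinP.
    - by move=> x _; rewrite lee_fin mulr_ge0.
    - by apply/measurable_EFinP; exact: measurable_funM.
    congr (_ + _); under eq_integral do rewrite EFinM.
    rewrite ge0_integralZl//.
    - by rewrite -QE// probability_setT mule1.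
    - exact/measurable_EFinP.
    - by move=> x _; rewrite lee_fin.
  transitivity (\int[Q']_x (((f x) ^+ 2)%:E + 1)).
    apply: eq_integral => x _; rewrite -!EFinD; congr EFin; ring.
  rewrite ge0_integralD//=.
  - by rewrite (integral_prob_cst Q' 1).
  - by move=> x _; rewrite lee_fin sqr_ge0.
  - by apply/measurable_EFinP; exact: measurable_funX.
have : \int[Q']_x ((f x - 1) ^+ 2)%:E + 2%:E <= v%:E + 2%:E.
  rewrite e; apply: (le_trans (leeD2r 1 fv)).
  by rewrite -!EFinD lee_fin; lra.
by rewrite leeD2rE.
Qed.

Let int_h : \int[Q']_x (h x)%:E <= (delta + v / delta)%:E.
Proof.
under eq_integral do rewrite EFinD EFinM.
have mg : measurable_fun setT (fun x => ((f x - 1) ^+ 2)%R).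
  by apply: measurable_funX; exact: measurable_funB.
rewrite ge0_integralD//=; last 3 first.
- by move=> x _; rewrite lee_fin ltW.
- by move=> x _; rewrite mule_ge0// lee_fin ?sqr_ge0// invr_ge0 ltW.
- by apply: emeasurable_funM => //; exact/measurable_EFinP.
rewrite integral_prob_cst EFinD leeD2l//.
rewrite ge0_integralZr//; last 3 first.
- exact/measurable_EFinP.
- by move=> x _; rewrite lee_fin sqr_ge0.
- by rewrite lee_fin invr_ge0 ltW.
by rewrite EFinM lee_wpmul2r// lee_fin invr_ge0 ltW.
Qed.

(* Split |f - 1| <= delta + (f - 1)^2 / delta, so that only the chi-square
   distance of [Q] to [Q'] is needed. *)
Lemma dTV_le_chi2 : dTV Q Q' <= (delta + v / delta)%:E.
Proof.
apply: ge_ereal_sup => _ [A mA <-].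
(* Expanding (f - 1 - delta)^2 / delta and (f - 1 + delta)^2 / delta, both nonnegative, gives 2 |f -
   1| <= h. *)
have f1 x : (f x <= 1 + h x)%R /\ (1 <= f x + h x)%R.
  have : (0 <= (f x - 1 - delta) ^+ 2 / delta)%R by rewrite mulr_ge0 ?sqr_ge0// invr_ge0 ltW.
  have : (0 <= (f x - 1 + delta) ^+ 2 / delta)%R by rewrite mulr_ge0 ?sqr_ge0// invr_ge0 ltW.
  have -> : ((f x - 1 - delta) ^+ 2 / delta = h x - 2 * (f x - 1))%R.
    by rewrite /h; field; rewrite gt_eqF.
  have -> : ((f x - 1 + delta) ^+ 2 / delta = h x + 2 * (f x - 1))%R.
    by rewrite /h; field; rewrite gt_eqF.
  have := h0 x; move=> *; split; lra.
have mhA : measurable_fun A (EFin \o h).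
  by apply/measurable_EFinP; exact: measurable_funTS.
have mfA : measurable_fun A (EFin \o f).
  by apply/measurable_EFinP; exact: measurable_funTS.
have hA : \int[Q']_(x in A) (h x)%:E <= (delta + v / delta)%:E.
  apply: le_trans int_h; apply: ge0_subset_integral => //.
  - exact/measurable_EFinP.
  - by move=> x _; rewrite lee_fin.
have le1 : Q A <= Q' A + (delta + v / delta)%:E.
  rewrite QE//.
  apply: le_trans (leeD2l _ hA).
  rewrite -[X in X + _]mul1e -integral_cst// -ge0_integralD//; last first.
    by move=> x _; rewrite lee_fin.
  apply: ge0_le_integral => //.
  - by move=> x _; rewrite lee_fin.
  - exact: emeasurable_funD.
  - by move=> x _; rewrite -EFinD lee_fin; have [] := f1 x.
have le2 : Q' A <= Q A + (delta + v / delta)%:E.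
  rewrite QE//.
  apply: le_trans (leeD2l _ hA).
  rewrite -[leLHS]mul1e -integral_cst// -ge0_integralD//; last 2 first.
    by move=> x _; rewrite lee_fin.
    by move=> x _; rewrite lee_fin.
  apply: ge0_le_integral => //.
  - exact: emeasurable_funD.
  - by move=> x _; rewrite -EFinD lee_fin; have [] := f1 x.
have QA : Q A \is a fin_num by rewrite fin_num_measure.
have QA' : Q' A \is a fin_num by rewrite fin_num_measure.
move: le1 le2; rewrite -(fineK QA) -(fineK QA') -!EFinD /= !lee_fin.
by move=> le1 le2; rewrite ler_norml; apply/andP; split; lra.
Qed.

End total_variation.

(** * Bayes' formula in a dominated model *)

Section bayes.
Local Open Scope ereal_scope.
Context d d' (Th : measurableType d) (Yt : measurableType d') (R : realType).
Variables (W : probability Th R) (M : probability Yt R) (l : Th -> Yt -> R).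
Hypothesis ml : measurable_fun setT (fun p : Th * Yt => l p.1 p.2).
Hypothesis l0 : forall t y, (0 <= l t y)%R.
Variables (lik : Th -> probability Yt R) (G : Yt -> probability Th R).
Hypothesis likE : forall t B, measurable B ->
  lik t B = \int[M]_(y in B) (l t y)%:E.
Hypothesis GE : forall y A, measurable A -> G y A = \int[W]_(t in A) (l t y)%:E.
Variable post : R.-pker Yt ~> Th.
Hypothesis post_posterior : is_posterior W lik post.

Let ml1 t : measurable_fun setT (l t).
Proof. exact: (measurableT_comp ml (measurable_pair1 t)). Qed.

Let ml2 y : measurable_fun setT (l ^~ y).
Proof. exact: (measurableT_comp ml (measurable_pair2 y)). Qed.

(** Uniqueness of densities with respect to [M]: integrated over any measurable [E], both sides give
    the joint probability of [A] and [E], by Tonelli. That each [G y] is a probability means that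
    [l] integrates to 1 against [W], so [M] is the marginal law of the observation. The exceptional
    set depends on [A] here. *)
Lemma posterior_ae_eq A : measurable A ->
  {ae M, forall y, post y A = G y A}.
Proof.
move=> mA.
have mp : measurable_fun setT (fun y => post y A) by exact: measurable_kernel.
pose f (p : Th * Yt) := (\1_A p.1 * l p.1 p.2)%:E.
have f0 p : 0 <= f p by rewrite lee_fin mulr_ge0.
have mf : measurable_fun setT f.
  apply/measurable_EFinP; apply: measurable_funM => //.
  by apply: measurableT_comp => //; exact: measurable_indic.
have GfE y : G y A = \int[W]_t f (t, y).
  rewrite GE// integral_mkcond; apply: eq_integral => t _.
  by rewrite patchE /f indicE; case: ifPn => /= _; rewrite ?mul1r ?mul0r.
have mG : measurable_fun setT (fun y => G y A).
  under eq_fun do rewrite GfE.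
  exact: measurable_fun_fubini_tonelli_G.
suff : ae_eq M setT (fun y => post y A) (fun y => G y A).
  by apply: filterS => y; apply.
apply: integral_ae_eq => //.
  apply/integrableP; split => //.
  apply: (@le_lt_trans _ _ (\int[M]_y cst 1 y)).
    apply: ge0_le_integral => //; first exact: measurableT_comp.
    by move=> y _; rewrite gee0_abs// -(prob_kernel (s := post) y); apply: le_measure; rewrite ?inE.
  by rewrite (integral_prob_cst M 1) ltry.
move=> E _ mE.
transitivity (\int[W]_t \int[lik t]_(y in E) post y A); last first.
  rewrite -post_posterior// [LHS]integral_mkcond.
  pose g p : \bar R := f p * (\1_E p.2)%:E.
  have g0 p : 0 <= g p by rewrite mule_ge0// lee_fin.
  have mg : measurable_fun setT g.
    apply: emeasurable_funM => //; apply/measurable_EFinP.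
    by apply: measurableT_comp => //; exact: measurable_indic.
  transitivity (\int[W]_t \int[M]_y g (t, y)).
    apply: eq_integral => t _; rewrite patchE /g /f/= indicE; case: ifPn => /= _.
      rewrite likE// integral_mkcond; apply: eq_integral => y _.
      by rewrite patchE indicE; case: ifPn => /= _; rewrite mul1r ?mule1 ?mule0.
    by rewrite integral0_eq// => y _; rewrite mul0r mul0e.
  rewrite fubini_tonelli// [RHS]integral_mkcond; apply: eq_integral => y _.
  rewrite patchE /g /= indicE; case: ifPn => /= _.
    by rewrite GfE; apply: eq_integral => t _; rewrite mule1.
  by rewrite integral0_eq// => t _; rewrite mule0.
pose g (p : Th * Yt) : \bar R := (l p.1 p.2)%:E * (post p.2 A * (\1_E p.2)%:E).
have h0 y : 0 <= post y A * (\1_E y)%:E by rewrite mule_ge0// lee_fin.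
have mh : measurable_fun setT (fun y => post y A * (\1_E y)%:E).
  by apply: emeasurable_funM => //; exact/measurable_EFinP.
have g0 p : 0 <= g p by rewrite mule_ge0// lee_fin.
have mg : measurable_fun setT g.
  apply: emeasurable_funM => //; first exact/measurable_EFinP.
  exact: (measurableT_comp mh).
transitivity (\int[W]_t \int[M]_y g (t, y)).
  rewrite fubini_tonelli// integral_mkcond; apply: eq_integral => y _.
  rewrite /g/= ge0_integralZr//.
  - rewrite -GE// probability_setT mul1e patchE indicE.
    by case: ifPn => /= _; rewrite ?mule1 ?mule0.
  - exact/measurable_EFinP.
  - by move=> t _; rewrite lee_fin.
apply: eq_integral => t _.
rewrite [RHS]integral_mkcond.
transitivity (\int[lik t]_y (post y A * (\1_E y)%:E)).
  rewrite (@ge0_integral_density _ _ _ M (lik t) (l t))//; last exact: likE.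
  by apply: eq_integral => y _; rewrite /g/= muleC.
apply: eq_integral => y _; rewrite patchE indicE.
by case: ifPn => /= _; rewrite ?mule1 ?mule0.
Qed.

End bayes.

(** * Integration, densities and null sets for finite products *)

Section product_probability.
Local Open Scope ereal_scope.
Context d (T : measurableType d) (R : realType).
Implicit Types n : nat.

Lemma tnth_tuple_cons0 n (p : T * n.-tuple T) : tnth (tuple_cons p) ord0 = p.1.
Proof. by []. Qed.

Lemma tnth_tuple_consS n (p : T * n.-tuple T) i :
  tnth (tuple_cons p) (lift ord0 i) = tnth p.2 i.
Proof. by case: p => x t; rewrite /tuple_cons/= tnthS. Qed.

Lemma measurable_prod_tnth n (f : 'I_n -> T -> R) :
  (forall i, measurable_fun setT (f i)) ->
  measurable_fun setT (fun x : n.-tuple T => \prod_(i < n) f i (tnth x i))%R.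
Proof.
move=> mf; apply: measurable_prod => i _.
by apply: measurableT_comp => //; exact: measurable_tnth.
Qed.

Lemma ge0_integral_prod_probS n (P : 'I_n.+1 -> probability T R)
    (f : n.+1.-tuple T -> \bar R) :
  measurable_fun setT f -> (forall x, 0 <= f x) ->
  \int[prod_prob P]_x f x =
  \int[P ord0]_x \int[prod_prob (fun i => P (lift ord0 i))]_t f (tuple_cons (x, t)).
Proof.
move=> mf f0.
transitivity (\int[P ord0 \x prod_prob (fun i => P (lift ord0 i))]_z
   (f \o @tuple_cons _ T n) z).
  by rewrite /= ge0_integral_distribution.
rewrite fubini_tonelli1//; last by move=> x; exact: f0.
exact: measurableT_comp (@measurable_tuple_cons _ T n).
Qed.

Lemma measurable_fun_integral_tail n (P : probability (n.-tuple T) R)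
    (f : n.+1.-tuple T -> \bar R) :
  measurable_fun setT f -> (forall x, 0 <= f x) ->
  measurable_fun setT (fun x => \int[P]_t f (tuple_cons (x, t))).
Proof.
move=> mf f0.
apply: (@measurable_fun_fubini_tonelli_F _ _ _ _ _ P (f \o @tuple_cons _ T n)).
- exact: measurableT_comp (@measurable_tuple_cons _ T n).
- by move=> x; exact: f0.
Qed.

Lemma measurable_fun_tuple_cons2 n (f : n.+1.-tuple T -> \bar R) x :
  measurable_fun setT f -> measurable_fun setT (fun t => f (tuple_cons (x, t))).
Proof.
move=> mf; apply: (measurableT_comp mf).
apply: (measurableT_comp (@measurable_tuple_cons _ T n)).
exact: measurable_pair1.
Qed.

Lemma ge0_integral_prod_prob n (P : 'I_n -> probability T R)
    (f : 'I_n -> T -> R) :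
  (forall i, measurable_fun setT (f i)) -> (forall i x, 0 <= f i x)%R ->
  \int[prod_prob P]_x (\prod_(i < n) f i (tnth x i))%R%:E =
  \prod_(i < n) \int[P i]_x (f i x)%:E.
Proof.
elim: n P f => [|n IH] P f mf f0.
  rewrite big_ord0 -[RHS](@integral_prob_cst _ _ _ (prod_prob P) 1).
  by apply: eq_integral => x _; rewrite big_ord0.
have F0 m (g : 'I_m -> T -> R) (x : m.-tuple T) : (forall i x, 0 <= g i x)%R ->
    0 <= (\prod_(i < m) g i (tnth x i))%:E.
  by move=> g0; rewrite lee_fin prodr_ge0.
rewrite ge0_integral_prod_probS//; last 2 first.
- by apply/measurable_EFinP; exact: measurable_prod_tnth.
- by move=> x; exact: F0.
rewrite big_ord_recl -(IH (fun i => P (lift ord0 i)) (fun i => f (lift ord0 i)))//.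
rewrite -ge0_integralZr//; last 3 first.
- exact/measurable_EFinP.
- by move=> x _; rewrite lee_fin.
- by apply: integral_ge0 => x _; apply: (F0 _ (fun i => f (lift ord0 i))) => i t; exact: f0.
apply: eq_integral => x _.
rewrite -ge0_integralZl//; last 3 first.
- apply/measurable_EFinP.
  by apply: (measurable_prod_tnth (f := fun i => f (lift ord0 i))) => i; exact: mf.
- by move=> t _; apply: (F0 _ (fun i => f (lift ord0 i))) => i u; exact: f0.
- by rewrite lee_fin.
apply: eq_integral => t _; rewrite -EFinM big_ord_recl tnth_tuple_cons0.
by congr (_ * _)%:E; apply: eq_bigr => i _; rewrite tnth_tuple_consS.
Qed.

Lemma ge0_integral_tnth n (P : 'I_n -> probability T R) (f : T -> R) i :
  measurable_fun setT f -> (forall x, 0 <= f x)%R ->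
  \int[prod_prob P]_x (f (tnth x i))%:E = \int[P i]_x (f x)%:E.
Proof.
move=> mf f0; pose g j := if j == i then f else cst 1%R.
have gE (F : 'I_n -> \bar R) : (forall j, j != i -> F j = 1) ->
    \prod_(j < n) F j = F i.
  by move=> F1; rewrite (bigD1 i)//= big1 ?mule1.
transitivity (\int[prod_prob P]_x (\prod_(j < n) g j (tnth x j))%R%:E).
  apply: eq_integral => x _; congr EFin.
  by rewrite (bigD1 i)//= big1 ?mulr1 /g ?eqxx// => j /negbTE ->.
rewrite ge0_integral_prod_prob//.
- rewrite gE /g ?eqxx// => j /negbTE ->.
  exact: (@integral_prob_cst _ _ _ (P j) 1).
- by move=> j; rewrite /g; case: ifP.
- by move=> j x; rewrite /g; case: ifP.
Qed.

(** Proved for functions rather than sets because the induction integrates out the tail of the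
    tuple, which leaves a general function of the first coordinate. *)
Lemma ge0_integral_prod_density n (P Q : 'I_n -> probability T R)
    (g : 'I_n -> T -> R) :
  (forall i, measurable_fun setT (g i)) -> (forall i x, 0 <= g i x)%R ->
  (forall i A, measurable A -> Q i A = \int[P i]_(x in A) (g i x)%:E) ->
  forall f : n.-tuple T -> \bar R, measurable_fun setT f -> (forall x, 0 <= f x) ->
  \int[prod_prob Q]_x f x =
  \int[prod_prob P]_x (f x * (\prod_(i < n) g i (tnth x i))%R%:E).
Proof.
elim: n P Q g => [|n IH] P Q g mg g0 QE f mf f0.
  by apply: eq_integral => x _; rewrite big_ord0 mule1.
have G0 m (h : 'I_m -> T -> R) (x : m.-tuple T) : (forall i x, 0 <= h i x)%R ->
    0 <= (\prod_(i < m) h i (tnth x i))%:E.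
  by move=> h0; rewrite lee_fin prodr_ge0.
rewrite !ge0_integral_prod_probS//; last 2 first.
- apply: emeasurable_funM => //.
  by apply/measurable_EFinP; exact: measurable_prod_tnth.
- by move=> x; rewrite mule_ge0// G0.
rewrite (@ge0_integral_density _ _ _ (P ord0) (Q ord0) (g ord0))//; last 3 first.
- exact: QE.
- exact: measurable_fun_integral_tail.
- by move=> x; exact: integral_ge0.
apply: eq_integral => x _.
rewrite (IH (fun i => P (lift ord0 i)) (fun i => Q (lift ord0 i))
  (fun i => g (lift ord0 i)))//; last 2 first.
- by move=> i A mA; exact: QE.
- exact: measurable_fun_tuple_cons2.
rewrite -ge0_integralZr//; last 3 first.
- apply: emeasurable_funM; first exact: measurable_fun_tuple_cons2.
  apply/measurable_EFinP.
  by apply: (measurable_prod_tnth (f := fun i => g (lift ord0 i))) => i; exact: mg.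
- by move=> t _; rewrite mule_ge0//; apply: (G0 _ (fun i => g (lift ord0 i))) => i u; exact: g0.
- by rewrite lee_fin.
apply: eq_integral => t _; rewrite -muleA -EFinM big_ord_recl tnth_tuple_cons0.
rewrite mulrC; congr (_ * (_ * _)%:E).
by apply: eq_bigr => i _; rewrite tnth_tuple_consS.
Qed.

Lemma prod_prob_density n (P Q : 'I_n -> probability T R) (g : 'I_n -> T -> R) :
  (forall i, measurable_fun setT (g i)) -> (forall i x, 0 <= g i x)%R ->
  (forall i A, measurable A -> Q i A = \int[P i]_(x in A) (g i x)%:E) ->
  forall A, measurable A ->
  prod_prob Q A = \int[prod_prob P]_(x in A) (\prod_(i < n) g i (tnth x i))%R%:E.
Proof.
move=> mg g0 QE A mA.
rewrite -(setIT A) -integral_indic// ?setIT.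
rewrite (ge0_integral_prod_density mg g0 QE)//; last first.
  exact/measurable_EFinP.
rewrite [RHS]integral_mkcond; apply: eq_integral => x _.
by rewrite patchE indicE; case: ifPn => _; rewrite ?mul1e ?mul0e.
Qed.

(** Absolute continuity passes to products without any density: by Tonelli, the sections of a
    [P]-null set are null except over a set [C] of first coordinates that is null for [P ord0],
    hence for [Q ord0]; the induction hypothesis handles the other sections. *)
Lemma prod_prob_null n (P Q : 'I_n -> probability T R) :
  (forall i A, measurable A -> P i A = 0 -> Q i A = 0) ->
  forall A, measurable A -> prod_prob P A = 0 -> prod_prob Q A = 0.
Proof.
elim: n P Q => [//|n IH] P Q PQ A mA.
have mf : measurable_fun setT (fun x : n.+1.-tuple T => (\1_A x)%:E : \bar R).
  by apply/measurable_EFinP; exact: measurable_indic.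
have f0 (x : n.+1.-tuple T) : 0 <= (\1_A x)%:E :> \bar R by rewrite lee_fin.
pose B x := [set t : n.-tuple T | A (tuple_cons (x, t))].
have mB x : measurable (B x).
  have mc := measurableT_comp (@measurable_tuple_cons _ T n) (measurable_pair1 x).
  by rewrite -[B x]setTI; exact: mc.
have PE (S : 'I_n.+1 -> probability T R) : prod_prob S A =
    \int[S ord0]_x prod_prob (fun i => S (lift ord0 i)) (B x).
  rewrite -(setIT A) -integral_indic// ?setIT ge0_integral_prod_probS//.
  apply: eq_integral => x _; rewrite -(setIT (B x)) -integral_indic// ?setIT.
have mS (S : 'I_n.+1 -> probability T R) :
    measurable_fun setT (fun x => prod_prob (fun i => S (lift ord0 i)) (B x)).
  have := measurable_fun_integral_tail (prod_prob (fun i => S (lift ord0 i))) mf f0.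
  congr measurable_fun; apply/funext => x.
  by rewrite -(setIT (B x)) -integral_indic// ?setIT.
rewrite !PE => P0.
have {}P0 : \int[P ord0]_x `|prod_prob (fun i => P (lift ord0 i)) (B x)| = 0.
  rewrite -[RHS]P0; apply: eq_integral => x _; rewrite gee0_abs//.
have {P0} : ae_eq (P ord0) setT (fun x => prod_prob (fun i => P (lift ord0 i)) (B x)) (cst 0).
  by apply/(ae_eq_integral_abs _ measurableT (mS P)).
pose C := [set x | prod_prob (fun i => P (lift ord0 i)) (B x) != 0].
have mC : measurable C by rewrite -[C]setTI; exact: measurable_neqe.
move=> aeP.
have PC : P ord0 C = 0.
  have : (P ord0).-negligible C.
    apply: negligibleS aeP => x /= Cx; apply/not_implyP; split => //.
    by apply/eqP; exact: Cx.
  by move/negligibleP; apply.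
rewrite -(integral0 (Q ord0) setT); apply: ge0_ae_eq_integral => //.
have /negligibleP QC : Q ord0 C = 0 by exact: PQ.
apply: (negligibleS _ (QC mC)) => x /= /not_implyP[_ h]; apply/negP => /eqP h0.
by apply: h; apply: IH h0 => // i D mD; exact: PQ.
Qed.

End product_probability.

(** * Boxes determine a finite measure on tuples *)

Section product_uniqueness.
Local Open Scope ereal_scope.
Context d (T : measurableType d) (R : realType) (n : nat).
Variable D : set (set T).
Hypotheses (DT : D setT) (DI : setI_closed D) (Dm : measurable = <<s D >>).

Definition box (E : 'I_n -> set T) : set (n.-tuple T) :=
  [set x | forall i, E i (tnth x i)].

Definition boxes := [set box E | E in [set E | forall i, D (E i)]].

Lemma measurable_box E : (forall i, measurable (E i)) -> measurable (box E).
Proof.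
move=> mE; rewrite (_ : box E =
    \big[setI/setT]_(i < n) ((@tnth n T ^~ i) @^-1` E i)).
  apply: bigsetI_measurable => i _; rewrite -[X in measurable X]setTI.
  exact: measurable_tnth.
rewrite -bigcap_seq; apply/seteqP; split => [x Bx i _|x Bx i]; first exact: Bx.
by apply: Bx; rewrite /= mem_index_enum.
Qed.

Let Dmeas A : D A -> measurable A.
Proof. by move=> DA; rewrite Dm; exact: sub_sigma_algebra. Qed.

Lemma sub_boxes_measurable : boxes `<=` measurable.
Proof. by move=> _ [E DE <-]; apply: measurable_box => i; exact: Dmeas. Qed.

(** The sets whose preimage under a given projection lies in the sigma-algebra of boxes form a
    sigma-algebra containing [D], since such a preimage is a box with all other sides equal to
    [setT]. The projections generate the measurable sets of tuples. *)
Lemma measurable_sub_boxes : measurable `<=` <<s boxes >>.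
Proof.
have h (i : 'I_n) : measurable `<=` [set B | <<s boxes >> ((@tnth n T ^~ i) @^-1` B)].
  rewrite Dm; apply: smallest_sub.
    split => /=.
    - by rewrite preimage_set0; exact: sigma_algebra0.
    - move=> A hA; rewrite setTD preimage_setC -setTD.
      by case: (smallest_sigma_algebra setT boxes) => _ h _; exact: h.
    - move=> F hF; rewrite preimage_bigcup.
      exact: sigma_algebra_bigcup.
  move=> A DA /=; apply: sub_sigma_algebra.
  exists (fun j => if j == i then A else setT).
    by move=> j /=; case: ifP.
  apply/seteqP; split => x /=; first by move/(_ i); rewrite eqxx.
  by move=> Ax j; case: eqP => [->|].
apply: smallest_sub; first exact: smallest_sigma_algebra.
rewrite -bigcup_seq/= => _ [i _ [B mB <-]]; rewrite setTI; exact: h.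
Qed.

Lemma boxes_setI_closed : setI_closed boxes.
Proof.
move=> _ _ [E DE <-] [F DF <-]; exists (fun i => E i `&` F i).
  by move=> i; exact: DI.
apply/seteqP; split => x /=.
  by move=> h; split => i; have [] := h i.
by move=> [h1 h2] i; split; [exact: h1|exact: h2].
Qed.

Lemma boxes_unique (m1 m2 : {measure set (n.-tuple T) -> \bar R}) :
  m1 setT < +oo ->
  (forall A, boxes A -> m1 A = m2 A) -> forall A, measurable A -> m1 A = m2 A.
Proof.
move=> m1oo m12 A /measurable_sub_boxes.
have BT : boxes setT.
  by exists (fun=> setT) => //; apply/seteqP; split.
apply: (@g_sigma_algebra_measure_unique _ _ _ boxes _ (fun=> setT)) => //.
- exact: sub_boxes_measurable.
- by rewrite bigcup_const//; exists 0%N.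
- exact: boxes_setI_closed.
Qed.

End product_uniqueness.

(** * A countable generating family on the real line *)

Section rational_boxes.
Context (R : realType).

(** [None] provides the whole line, so that a box may leave coordinates unconstrained; indexing by
    [option rat] keeps the family countable. *)
Definition rational_ray (o : option rat) : set R :=
  if o is Some q then `]-oo, ratr q[%classic else setT.

Definition rational_rays : set (set R) := range rational_ray.

Lemma rational_raysT : rational_rays setT.
Proof. by exists None. Qed.

Lemma rational_rays_setI_closed : setI_closed rational_rays.
Proof.
move=> _ _ [[p|] _ <-] [[q|] _ <-].
- exists (Some (Num.min p q)) => //=.
  apply/seteqP; split => x /=; rewrite !in_itv/= ?lteBSide/=.
    move=> xpq; split; apply: (lt_le_trans xpq); rewrite ler_rat ge_min lexx// orbT//.
  by move=> [xp xq]; case: (leP p q).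
- by exists (Some p) => //=; rewrite setIT.
- by exists (Some q) => //=; rewrite setTI.
- by exists None => //=; rewrite setIT.
Qed.

Lemma measurable_rational_rays : (measurable : set (set R)) = <<s rational_rays >>.
Proof.
apply/seteqP; split; last first.
  apply: smallest_sub; first exact: sigma_algebra_measurable.
  by move=> _ [[q|] _ <-] //=; exact: measurable_itv.
have -> : (measurable : set (set R)) = <<s @RGenInftyO.G R >>.
  exact: RGenInftyO.measurableE.
apply: smallest_sub; first exact: smallest_sigma_algebra.
move=> _ [x ->].
(* By density of the rationals, the ray is the union of the rational rays with endpoint below [x];
   codes of no rational, or of one not below [x], contribute [set0]. *)
have -> : `]-oo, x[%classic =
    \bigcup_n (if unpickle n is Some q then
      if (ratr q : R) < x then rational_ray (Some q) else set0 else set0).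
  apply/seteqP; split => y /=; rewrite in_itv/=.
    move=> /rat_in_itvoo[q]; rewrite in_itv/= => /andP[yq qx].
    by exists (pickle q); [exact: I|rewrite pickleK qx /rational_ray /= in_itv].
  move=> [n _]; case: unpickle => // q; case: ifPn => //= qx.
  by rewrite in_itv/= => yq; exact: lt_trans yq qx.
apply: sigma_algebra_bigcup => n; case: unpickle => [q|]; last exact: sigma_algebra0.
case: ifPn => _; last exact: sigma_algebra0.
by apply: sub_sigma_algebra; exists (Some q).
Qed.

End rational_boxes.

(** * Normal laws on the line *)

Section normal_densities.
Context (R : realType).
Implicit Types m s t x y : R.
Local Notation mu := (@lebesgue_measure R).

Let kappa : R := Num.sqrt (pi *+ 2).

Let kappa_gt0 : 0 < kappa.
Proof. by rewrite sqrtr_gt0 mulrn_wgt0// pi_gt0. Qed.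

Lemma normal_pdf_gt0E m s x : 0 < s ->
  normal_pdf m s x = (s * kappa)^-1 * expR (- ((x - m) ^+ 2 / (s ^+ 2 *+ 2))).
Proof.
move=> s0; rewrite normal_pdfE ?gt_eqF// /normal_peak /normal_fun mulNr.
congr (_^-1 * _); rewrite -mulrnAr sqrtrM ?sqr_ge0//.
by rewrite sqrtr_sqr gtr0_norm.
Qed.

Lemma normal_pdf_gt0 m s x : 0 < s -> 0 < normal_pdf m s x.
Proof.
by move=> s0; rewrite normal_pdf_gt0E// mulr_gt0 ?expR_gt0// invr_gt0 mulr_gt0.
Qed.

Lemma ge0_integral_normal_law m s (f : R -> \bar R) :
  measurable_fun setT f -> (forall x, 0 <= f x)%E ->
  (\int[normal_law m s]_x f x = \int[mu]_x (f x * (normal_pdf m s x)%:E))%E.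
Proof.
move=> mf f0; rewrite ge0_integral_distribution//.
rewrite -(@ge0_integral_density _ _ _ mu (normal_prob m s) (normal_pdf m s))//.
- exact: measurable_normal_pdf.
- by move=> x; exact: normal_pdf_ge0.
Qed.

Definition normal_ratio m s m' s' x := normal_pdf m s x / normal_pdf m' s' x.

Lemma measurable_normal_pdf_inv m s : 0 < s ->
  measurable_fun setT (fun x => (normal_pdf m s x)^-1).
Proof.
move=> s0.
rewrite (_ : (fun _ => _) =
    fun x => (s * kappa) * expR ((x - m) ^+ 2 / (s ^+ 2 *+ 2))); last first.
  by apply/funext => x; rewrite normal_pdf_gt0E// invfM invrK -expRN opprK.
apply: measurable_funM => //; apply: measurableT_comp => //.
apply: measurable_funM => //; apply: measurable_funX; exact: measurable_funB.
Qed.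

Lemma measurable_normal_ratio m s m' s' : 0 < s' ->
  measurable_fun setT (normal_ratio m s m' s').
Proof.
move=> s'0; apply: measurable_funM; first exact: measurable_normal_pdf.
exact: measurable_normal_pdf_inv.
Qed.

Lemma normal_ratio_ge0 m s m' s' x : 0 <= normal_ratio m s m' s' x.
Proof. by rewrite mulr_ge0 ?invr_ge0 ?normal_pdf_ge0. Qed.

Lemma normal_law_density m s m' s' A : 0 < s' -> measurable A ->
  (normal_law m s A =
   \int[normal_law m' s']_(x in A) (normal_ratio m s m' s' x)%:E)%E.
Proof.
move=> s'0 mA; rewrite [RHS]integral_mkcond.
rewrite (_ : _ \_ A = fun x => ((\1_A x)%:E * (normal_ratio m s m' s' x)%:E)%E).
  rewrite ge0_integral_normal_law//; last 2 first.
  - apply: emeasurable_funM; apply/measurable_EFinP => //.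
    exact: measurable_normal_ratio.
  - by move=> x; rewrite mule_ge0 ?lee_fin ?normal_ratio_ge0.
  rewrite normal_lawE /normal_prob integral_mkcond; apply: eq_integral => x _.
  rewrite patchE indicE; case: ifPn => _; rewrite ?mul1e ?mul0e//.
  by rewrite -EFinM /normal_ratio divfK// gt_eqF// normal_pdf_gt0.
apply/funext => x; rewrite patchE indicE.
by case: ifPn => _; rewrite ?mul1e ?mul0e.
Qed.

(* Both sides are the joint density of (t, y) for t ~ N(0, tau^2) and
   y | t ~ N(t, sigma^2), divided by the product of the marginals. *)
Lemma normal_ratio_bayes sigma tau M t y : 0 < sigma -> 0 < tau -> 0 < M ->
  M ^+ 2 = sigma ^+ 2 + tau ^+ 2 ->
  normal_ratio t sigma 0 M y =
  normal_ratio (tau ^+ 2 / M ^+ 2 * y) (sigma * tau / M) 0 tau t.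
Proof.
move=> s0 t0 M0 ME.
have sM0 : 0 < sigma * tau / M by rewrite divr_gt0 ?mulr_gt0.
rewrite /normal_ratio !normal_pdf_gt0E//.
set c := tau ^+ 2 / M ^+ 2.
rewrite !invfM !invrK -!expRN.
rewrite [LHS](_ : _ = (M / sigma) * (kappa^-1 * kappa) *
  expR (- ((y - t) ^+ 2 / (sigma ^+ 2 *+ 2)) + (y - 0) ^+ 2 / (M ^+ 2 *+ 2))); last first.
  by rewrite expRD opprK; ring.
rewrite [RHS](_ : _ = (M / sigma) * (kappa^-1 * kappa) *
  expR (- ((t - c * y) ^+ 2 / ((sigma * tau / M) ^+ 2 *+ 2))
    + (t - 0) ^+ 2 / (tau ^+ 2 *+ 2))); last first.
  by rewrite expRD opprK; field; rewrite !gt_eqF.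
congr (_ * expR _); rewrite !subr0 -!(mulr_natr (_ ^+ 2)).
(* The normalising constants agree and only the exponents remain. Eliminating [sigma] turns their
   equality into a rational identity in [M], [tau], [t] and [y]. *)
have ME' : sigma ^+ 2 = M ^+ 2 - tau ^+ 2 by rewrite ME addrK.
rewrite !exprMn exprVn /c ME'.
have h : 0 < M ^+ 2 - tau ^+ 2 by rewrite -ME' exprn_gt0.
by field; rewrite !gt_eqF.
Qed.

(** Joint measurability in the mean and the point, which Tonelli requires in Bayes' formula. *)
Lemma measurable_normal_ratio2 sigma M : 0 < sigma -> 0 < M ->
  measurable_fun setT (fun p : R * R => normal_ratio p.1 sigma 0 M p.2).
Proof.
move=> s0 M0.
rewrite (_ : (fun _ => _) = fun p : R * R => ((sigma * kappa)^-1 * (M * kappa)) *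
  (expR (- ((p.2 - p.1) ^+ 2 / (sigma ^+ 2 *+ 2))) *
   expR ((p.2 - 0) ^+ 2 / (M ^+ 2 *+ 2)))); last first.
  apply/funext => p; rewrite /normal_ratio !normal_pdf_gt0E// [X in _ * X = _]invfM.
  by rewrite invrK -expRN opprK mulrACA.
apply: measurable_funM => //; apply: measurable_funM.
  apply: measurableT_comp => //; apply: measurableT_comp => //.
  by apply: measurable_funM => //; apply: measurable_funX; exact: measurable_funB.
apply: measurableT_comp => //.
by apply: measurable_funM => //; apply: measurable_funX; exact: measurable_funB.
Qed.

(** Completing the square, the squared ratio times the density of N(a, sigma^2) is a multiple of the
    density of N(c, rho^2), with rho^2 = s^2 / (1 + e). The integral is thus exactly the multiple K
    exp((b - a)^2 / ((1 + e) sigma^2)), where K = (1 - e^2)^(-1/2) is at most exp(e^2). *)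
Lemma normal_chi2_le a b sigma s e : 0 < sigma -> 0 < s -> 0 <= e ->
  e ^+ 2 <= 2^-1 -> s ^+ 2 = (1 - e) * sigma ^+ 2 ->
  (\int[normal_law a sigma]_x ((normal_ratio b s a sigma x) ^+ 2)%:E <=
   (expR (e ^+ 2 + (b - a) ^+ 2 / sigma ^+ 2))%:E)%E.
Proof.
move=> sg0 s0 e0 e2 sE.
have e1 : 0 < 1 - e.
  by rewrite -(pmulr_lgt0 _ (exprn_gt0 2 sg0)) -sE exprn_gt0.
pose q := Num.sqrt (1 + e).
have q0 : 0 < q by rewrite sqrtr_gt0 ltr_wpDr.
have q2 : q ^+ 2 = 1 + e by rewrite sqr_sqrtr// addr_ge0.
pose rho := s / q.
have r0 : 0 < rho by rewrite divr_gt0.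
pose c := (2 * b - (1 - e) * a) / (1 + e).
pose K := sigma / (s * q).
have K0 : 0 <= K by rewrite divr_ge0 ?mulr_ge0 ?ltW.
have E x : (normal_ratio b s a sigma x) ^+ 2 * normal_pdf a sigma x =
    K * expR ((b - a) ^+ 2 / ((1 + e) * sigma ^+ 2)) * normal_pdf c rho x.
  set G := (b - a) ^+ 2 / ((1 + e) * sigma ^+ 2).
  rewrite /normal_ratio expr_div_n expr2 [X in _ / X]expr2 invfM mulrA.
  rewrite divfK ?gt_eqF ?normal_pdf_gt0//.
  rewrite !normal_pdf_gt0E// !invfM !invrK -!expRN.
  rewrite [LHS](_ : _ = (sigma / (s ^+ 2 * kappa)) *
    expR (- ((x - b) ^+ 2 / (s ^+ 2 *+ 2)) - ((x - b) ^+ 2 / (s ^+ 2 *+ 2)) +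
      (x - a) ^+ 2 / (sigma ^+ 2 *+ 2))); last first.
    by rewrite !expRD opprK; field; rewrite !gt_eqF.
  rewrite [RHS](_ : _ = (sigma / (s ^+ 2 * kappa)) *
    expR (G - ((x - c) ^+ 2 / (rho ^+ 2 *+ 2)))); last first.
    by rewrite expRD /K /rho; field; rewrite !gt_eqF.
  congr (_ * expR _); rewrite -!(mulr_natr (_ ^+ 2)) /rho expr_div_n q2 sE /c /G.
  by field; rewrite !gt_eqF// ltr_wpDr.
rewrite ge0_integral_normal_law; last 2 first.
- by apply/measurable_EFinP; apply: measurable_funX; exact: measurable_normal_ratio.
- by move=> x; rewrite lee_fin sqr_ge0.
under eq_integral do rewrite -EFinM E EFinM.
rewrite ge0_integralZl//; last 3 first.
- by apply/measurable_EFinP; exact: measurable_normal_pdf.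
- by move=> x _; rewrite lee_fin normal_pdf_ge0.
- by rewrite lee_fin mulr_ge0 ?expR_ge0.
rewrite integral_normal_pdf mule1 lee_fin expRD.
apply: ler_pM; rewrite ?expR_ge0//.
- have K2 : K ^+ 2 <= expR (e ^+ 2) ^+ 2.
    have -> : K ^+ 2 = (1 - e ^+ 2)^-1.
      rewrite /K expr_div_n exprMn sE q2; field.
      by rewrite !gt_eqF//= ?subr_gt0 ?ltr_wpDr//; nra.
    (* With x = e^2, exp(x)^2 (1 - x) >= (1 + x)^2 (1 - x), and the latter is at least 1 for 0 <= x
       <= 1/2. *)
    have h : e ^+ 2 + 1 <= expR (e ^+ 2) by rewrite addrC expR_ge1Dx.
    have h1 : 0 < 1 - e ^+ 2 by lra.
    rewrite -(ler_pM2r h1) mulVf ?gt_eqF//.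
    have e20 := sqr_ge0 e.
    nra.
  by rewrite -(@ler_pXn2r _ 2)// nnegrE// expR_ge0.
- rewrite ler_expR ler_wpM2l ?sqr_ge0// lef_pV2 ?posrE ?mulr_gt0 ?exprn_gt0// ?ltr_wpDr//.
  by rewrite ler_peMl ?sqr_ge0// lerDl.
Qed.

(** A crude constant: with u = (x - m)^2 / (4 s^2) the density is proportional to exp(-2u), and u
    exp(-u) <= 1 leaves exp(-u), the profile of N(m, 2 s^2). The change of normalisation gives 4
    sqrt(2) s^2, rounded up to 8 s^2. *)
Lemma normal_second_moment_le m s : 0 < s ->
  (\int[normal_law m s]_x ((x - m) ^+ 2)%:E <= (8 * s ^+ 2)%:E)%E.
Proof.
move=> s0.
have s2 : 0 < s * Num.sqrt 2 by rewrite mulr_gt0 ?sqrtr_gt0.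
have mX : measurable_fun setT (fun x => (x - m) ^+ 2).
  by apply: measurable_funX; exact: measurable_funB.
rewrite ge0_integral_normal_law; last 2 first.
- exact/measurable_EFinP.
- by move=> x; rewrite lee_fin sqr_ge0.
rewrite -[leRHS]mule1 -(integral_normal_pdf m (s * Num.sqrt 2)).
rewrite -ge0_integralZl//; last 3 first.
- by apply/measurable_EFinP; exact: measurable_normal_pdf.
- by move=> x _; rewrite lee_fin normal_pdf_ge0.
- by rewrite lee_fin mulr_ge0 ?sqr_ge0.
apply: ge0_le_integral => //.
- by move=> x _; rewrite mule_ge0 ?lee_fin ?sqr_ge0 ?normal_pdf_ge0.
- apply: emeasurable_funM; apply/measurable_EFinP => //.
  exact: measurable_normal_pdf.
- apply: emeasurable_funM => //; apply/measurable_EFinP.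
  exact: measurable_normal_pdf.
move=> x _; rewrite -!EFinM lee_fin !normal_pdf_gt0E//.
pose u := (x - m) ^+ 2 / (4 * s ^+ 2).
have uE : (x - m) ^+ 2 = 4 * s ^+ 2 * u by rewrite /u mulrC divfK// gt_eqF// mulr_gt0// exprn_gt0.
have q2 : Num.sqrt 2 ^+ 2 = 2 :> R by rewrite sqr_sqrtr.
have -> : (x - m) ^+ 2 / (s ^+ 2 *+ 2) = u + u.
  by rewrite -mulr_natr /u; field; rewrite gt_eqF.
have -> : (x - m) ^+ 2 / ((s * Num.sqrt 2) ^+ 2 *+ 2) = u.
  by rewrite exprMn q2 -mulr_natr /u; field; rewrite gt_eqF.
have qle : Num.sqrt 2 <= 2 :> R.
  by rewrite -(@ler_pXn2r _ 2)// ?nnegrE// q2; lra.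
have u_le : u <= expR u by apply: le_trans (expR_ge1Dx u); rewrite lerDr.
rewrite opprD expRD uE.
rewrite [leRHS](_ : _ = s ^+ 2 * 4 * (s * kappa)^-1 * expR (- u) * (2 / Num.sqrt 2)); last first.
  by field; rewrite !gt_eqF// sqrtr_gt0.
rewrite [leLHS](_ : _ = s ^+ 2 * 4 * (s * kappa)^-1 * expR (- u) * (u * expR (- u))); last first.
  by ring.
rewrite ler_wpM2l//.
  apply: mulr_ge0; last exact: expR_ge0.
  apply: mulr_ge0; first by rewrite mulr_ge0 ?sqr_ge0.
  by rewrite invr_ge0 mulr_ge0// ltW.
apply: (@le_trans _ _ 1).
  by rewrite expRN ler_pdivrMr ?expR_gt0// mul1r.
by rewrite ler_pdivlMr ?sqrtr_gt0// mul1r.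
Qed.

(** The density is positive everywhere, so Lebesgue measure has density 1 / [normal_pdf] with
    respect to the normal law. *)
Lemma normal_null_lebesgue m s A : 0 < s -> measurable A ->
  normal_law m s A = 0%E -> mu A = 0%E.
Proof.
move=> s0 mA A0.
have mi := measurable_normal_pdf_inv m s0.
transitivity (\int[normal_law m s]_(x in A) ((normal_pdf m s x)^-1)%:E)%E.
  rewrite [RHS]integral_mkcond.
  rewrite (_ : _ \_ A = fun x => ((\1_A x)%:E * ((normal_pdf m s x)^-1)%:E)%E).
    rewrite ge0_integral_normal_law//; last 2 first.
    - by apply: emeasurable_funM; apply/measurable_EFinP.
    - by move=> x; rewrite mule_ge0 ?lee_fin ?invr_ge0 ?normal_pdf_ge0.
    rewrite -[in LHS](setIT A) -integral_indic//; apply: eq_integral => x _.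
    have h : normal_pdf m s x != 0 by rewrite gt_eqF// normal_pdf_gt0.
    by rewrite -muleA -!EFinM (mulVf h) mulr1.
  apply/funext => x; rewrite patchE indicE.
  by case: ifPn => _; rewrite ?mul1e ?mul0e.
apply: null_set_integral => //.
by apply/measurable_EFinP; exact: measurable_funTS.
Qed.

(** The pushforward of Lebesgue measure by x -> a + b x, multiplied by b, agrees with Lebesgue
    measure on half-open intervals, hence everywhere. *)
Lemma lebesgue_null_affine a b A : 0 < b -> measurable A -> mu A = 0%E ->
  mu ((fun x => a + b * x) @^-1` A) = 0%E.
Proof.
move=> b0 mA A0.
pose f (x : measurableTypeR R) : measurableTypeR R := a + b * x.
have mf : measurable_fun setT f.
  by apply: measurable_funD => //; exact: measurable_funM.
pose mfun_f := isMeasurableFun.Build _ _ _ _ f mf.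
pose g : {mfun measurableTypeR R >-> measurableTypeR R} := HB.pack f mfun_f.
pose k : {nonneg R} := NngNum (ltW b0).
have e : mscale k (pushforward mu g) A = mu A.
  symmetry; apply: (@lebesgue_measure_unique _ (mscale k (pushforward mu g))) => //= _ [[x y]] _ <-.
  rewrite /mscale/= /pushforward.
  have -> : f @^-1` `]x, y] = `](x - a) / b, (y - a) / b]%classic.
    apply/seteqP; split => z /=; rewrite !in_itv/= /f.
      by rewrite ltr_pdivrMr// ler_pdivlMr// ltrBlDl lerBrDl mulrC.
    by rewrite ltr_pdivrMr// ler_pdivlMr// ltrBlDl lerBrDl mulrC.
  rewrite !lebesgue_measure_itv/= !lte_fin ltr_pM2r ?invr_gt0// ltrD2r.
  case: ifPn => _; last by rewrite mule0.
  by rewrite -EFinB -EFinM; congr EFin; field; rewrite gt_eqF.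
have /eqP : (b%:E * mu (f @^-1` A) = 0)%E by rewrite -A0 -e.
by rewrite mule_eq0 eqe gt_eqF//= => /eqP.
Qed.

End normal_densities.

(** * Gaussian vectors: posterior and effect of shrinkage *)

Section gaussian.
Context (R : realType) (k : nat).
Implicit Types (m y : k.-tuple R) (s : R).

Definition gaussian_ratio m s m' s' (x : k.-tuple R) :=
  \prod_(i < k) normal_ratio (tnth m i) s (tnth m' i) s' (tnth x i).

Lemma gaussian_ratio_ge0 m s m' s' x : 0 <= gaussian_ratio m s m' s' x.
Proof. by apply: prodr_ge0 => i _; exact: normal_ratio_ge0. Qed.

Lemma measurable_gaussian_ratio m s m' s' : 0 < s' ->
  measurable_fun setT (gaussian_ratio m s m' s').
Proof.
move=> s'0.
apply: (measurable_prod_tnth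
  (f := fun i => normal_ratio (tnth m i) s (tnth m' i) s')) => i.
exact: measurable_normal_ratio.
Qed.

Lemma gaussian_density m s m' s' A : 0 < s' -> measurable A ->
  (gaussian m s A =
   \int[gaussian m' s']_(x in A) (gaussian_ratio m s m' s' x)%:E)%E.
Proof.
move=> s'0 mA.
apply: (prod_prob_density
  (g := fun i => normal_ratio (tnth m i) s (tnth m' i) s')) => //.
- by move=> i; exact: measurable_normal_ratio.
- by move=> i x; exact: normal_ratio_ge0.
- by move=> i B mB; exact: normal_law_density.
Qed.

Definition scale_tuple (c : R) y : k.-tuple R := [tuple c * tnth y i | i < k].

Local Notation origin := (truncation k (fun=> 0 : R)).

Variables (sigma tau : R).
Hypotheses (sigma_gt0 : 0 < sigma) (tau_gt0 : 0 < tau).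
Let M := Num.sqrt (sigma ^+ 2 + tau ^+ 2).

Let M2 : M ^+ 2 = sigma ^+ 2 + tau ^+ 2.
Proof. by rewrite sqr_sqrtr// addr_ge0// sqr_ge0. Qed.

Let M_gt0 : 0 < M.
Proof. by rewrite sqrtr_gt0 ltr_wpDr ?sqr_ge0// exprn_gt0. Qed.

(** Bayes' formula gives a null set for each [A]. The union of those attached to rational boxes is
    still null, and off it the two laws agree on all such boxes, hence on all measurable sets. *)
Lemma gaussian_posterior_ae (post : R.-pker k.-tuple R ~> k.-tuple R) :
  is_posterior (gaussian origin tau) (fun theta => gaussian theta sigma) post ->
  {ae gaussian origin M, forall y, forall A, measurable A ->
    post y A =
    gaussian (scale_tuple (tau ^+ 2 / M ^+ 2) y) (sigma * tau / M) A}.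
Proof.
move=> hpost.
pose G y := gaussian (scale_tuple (tau ^+ 2 / M ^+ 2) y) (sigma * tau / M).
pose l t y := gaussian_ratio t sigma origin M y.
have lE t y : l t y =
    gaussian_ratio (scale_tuple (tau ^+ 2 / M ^+ 2) y) (sigma * tau / M) origin tau t.
  apply: eq_bigr => i _; rewrite !tnth_mktuple.
  exact: normal_ratio_bayes.
have ml : measurable_fun setT (fun p : k.-tuple R * k.-tuple R => l p.1 p.2).
  apply: measurable_prod => i _.
  rewrite (_ : (fun _ => _) = (fun p => normal_ratio p.1 sigma 0 M p.2) \o
    (fun p : k.-tuple R * k.-tuple R => (tnth p.1 i, tnth p.2 i))); last first.
    by apply/funext => p /=; rewrite !tnth_mktuple.
  apply: measurableT_comp; first exact: measurable_normal_ratio2.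
  apply: measurable_fun_pair.
    exact: measurableT_comp (measurable_tnth i) measurable_fst.
  exact: measurableT_comp (measurable_tnth i) measurable_snd.
have aeA A : measurable A -> {ae gaussian origin M, forall y, post y A = G y A}.
  apply: (@posterior_ae_eq _ _ _ _ _ (gaussian origin tau) (gaussian origin M) l ml
    _ (fun theta => gaussian theta sigma)) => //.
  - by move=> t y; exact: gaussian_ratio_ge0.
  - by move=> t B mB; exact: gaussian_density.
  - move=> y B mB; rewrite /G (gaussian_density _ _ origin tau_gt0 mB).
    by apply: eq_integral => t _; rewrite lE.
(* Finite functions into a countable type are countable, so [unpickle] enumerates all these
   boxes. *)
pose ray (f : {ffun 'I_k -> option rat}) : set (k.-tuple R) :=
  box (fun i => @rational_ray R (f i)).
have mray f : measurable (ray f).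
  apply: measurable_box => i; rewrite measurable_rational_rays.
  by apply: sub_sigma_algebra; exists (f i).
have : {ae gaussian origin M, forall y, forall n : nat,
    if unpickle n is Some f then post y (ray f) = G y (ray f) else True}.
  apply/ae_foralln => n; case: unpickle => [f|]; first exact: aeA.
  by apply: aeW.
apply: filterS => y hy.
apply: (@boxes_unique _ R R k (@rational_rays R)).
- exact: rational_raysT.
- exact: rational_rays_setI_closed.
- exact: measurable_rational_rays.
- by rewrite prob_kernel ltry.
move=> _ [E DE <-].
have ex i : exists o, @rational_ray R o = E i by have [q _ qE] := DE i; exists q.
have [g gE] := choice ex.
have -> : box E = ray (finfun g).
  by rewrite /ray; congr box; apply/funext => i; rewrite ffunE gE.
by have := hy (pickle (finfun g)); rewrite pickleK.
Qed.

(** The factor 2 / delta + 2 makes the bound linear in Z in two cases. If Z <= 1/2, then exp Z <= 1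
    / (1 - Z) <= 1 + 2 Z, so the chi-square distance is at most 2 Z; if Z > 1/2, the trivial bound 1
    is below 2 Z. *)
Lemma gaussian_shrink_dTV_le (e s delta : R) y : 0 <= e -> e ^+ 2 <= 2^-1 ->
  0 < s -> s ^+ 2 = (1 - e) * sigma ^+ 2 -> 0 < delta ->
  (dTV (gaussian (scale_tuple (1 - e) y) s) (gaussian y sigma) <=
   (delta + (2 / delta + 2) *
     \sum_(i < k) (e ^+ 2 + e ^+ 2 / sigma ^+ 2 * tnth y i ^+ 2))%:E)%E.
Proof.
move=> e0 e2 s0 sE d0; set Z := \sum_(i < k) _.
have Z0 : 0 <= Z.
  by apply: sumr_ge0 => i _; rewrite addr_ge0 ?sqr_ge0// mulr_ge0 ?sqr_ge0// divr_ge0 ?sqr_ge0.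
have d1 : 0 <= delta^-1 by rewrite invr_ge0 ltW.
have dZ : 0 <= 2 / delta * Z by rewrite !mulr_ge0.
have [Z2|Z2] := leP Z 2^-1; last first.
  by apply: (le_trans (dTV_le1 _ _)); rewrite lee_fin mulrDl; lra.
set f := gaussian_ratio (scale_tuple (1 - e) y) s y sigma.
apply: (@le_trans _ _ (delta + (2 * Z) / delta)%:E); last first.
  have -> : 2 * Z / delta = 2 / delta * Z by rewrite mulrAC.
  by rewrite lee_fin mulrDl; lra.
apply: (@dTV_le_chi2 _ _ _ _ _ f) => //.
- exact: measurable_gaussian_ratio.
- by move=> x; exact: gaussian_ratio_ge0.
- by move=> A mA; exact: gaussian_density.
apply: (@le_trans _ _ (expR Z)%:E); last first.
  rewrite lee_fin.
  have h1 : 0 < 1 - Z by lra.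
  have h2 := expR_ge1Dx (- Z).
  have h3 := expR_gt0 Z.
  have h4 : expR Z * expR (- Z) = 1 by rewrite -expRD addrN expR0.
  nra.
rewrite [leLHS](_ : _ = \prod_(i < k)
   \int[normal_law (tnth y i) sigma]_x ((normal_ratio ((1 - e) * tnth y i) s (tnth y i) sigma x) ^+ 2)%:E)%E.
  rewrite expR_sum -prodEFin.
  (* Nonnegativity is carried along with the comparison, as multiplying inequalities requires it. *)
  pose below (a b : \bar R) := (0 <= a)%E /\ (a <= b)%E.
  suff : below (\prod_(i < k) \int[normal_law (tnth y i) sigma]_x
      ((normal_ratio ((1 - e) * tnth y i) s (tnth y i) sigma x) ^+ 2)%:E)%E
      (\prod_(i < k) (expR (e ^+ 2 + e ^+ 2 / sigma ^+ 2 * tnth y i ^+ 2))%:E)%E.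
    by case.
  apply: (big_ind2 below).
  - by split.
  - move=> a1 b1 a2 b2 [a10 ab1] [a20 ab2].
    by split; [exact: mule_ge0|exact: lee_pmul].
  move=> i _; split; first by apply: integral_ge0 => x _; rewrite lee_fin sqr_ge0.
  apply: (le_trans (normal_chi2_le _ _ sigma_gt0 s0 e0 e2 sE)).
  rewrite lee_fin ler_expR lerD2l.
  rewrite [leLHS](_ : _ = e ^+ 2 / sigma ^+ 2 * tnth y i ^+ 2)//; ring.
rewrite -(@ge0_integral_prod_prob _ _ R k (fun i => normal_law (tnth y i) sigma)
  (fun i x => normal_ratio ((1 - e) * tnth y i) s (tnth y i) sigma x ^+ 2)); last 2 first.
- by move=> i; apply: measurable_funX; exact: measurable_normal_ratio.
- by move=> i x; exact: sqr_ge0.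
apply: eq_integral => x _; rewrite /f /gaussian_ratio -prodrXl.
by congr EFin; apply: eq_bigr => i _; rewrite tnth_mktuple.
Qed.

End gaussian.

(** * Expectations under the true parameter *)

Section observations.
Context (R : realType) d (Omega : measurableType d) (P : probability Omega R).
Variable xi : nat -> {RV P >-> R}.
Hypothesis xi_normal : forall j (A : set R), measurable A ->
  distribution P (xi j) A = normal_prob 0 1 A.
Hypothesis xi_indep : mutually_independent xi.
Variables (k : nat) (theta0 : nat -> R) (sigma tau : R).
Hypotheses (sigma_gt0 : 0 < sigma) (tau_gt0 : 0 < tau).

Let M := Num.sqrt (sigma ^+ 2 + tau ^+ 2).

Let M2 : M ^+ 2 = sigma ^+ 2 + tau ^+ 2.
Proof. by rewrite sqr_sqrtr// addr_ge0// sqr_ge0. Qed.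

Let M_gt0 : 0 < M.
Proof. by rewrite sqrtr_gt0 ltr_wpDr ?sqr_ge0// exprn_gt0. Qed.

Let e := sigma ^+ 2 / M ^+ 2.

Let e_ge0 : 0 <= e.
Proof. by rewrite divr_ge0 ?sqr_ge0. Qed.

Let e_le1 : e <= 1.
Proof.
by rewrite ler_pdivrMr ?exprn_gt0// mul1r M2 lerDl sqr_ge0.
Qed.

Let shrinkE : tau ^+ 2 / M ^+ 2 = 1 - e.
Proof.
have h : M ^+ 2 != 0 by rewrite gt_eqF// exprn_gt0.
by rewrite -(divff h) /e -mulrBl M2 addrAC subrr add0r.
Qed.

Let s := sigma * tau / M.

Let s_gt0 : 0 < s.
Proof. by rewrite divr_gt0// mulr_gt0. Qed.

Let s2 : s ^+ 2 = (1 - e) * sigma ^+ 2.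
Proof. by rewrite -shrinkE /s !exprMn exprVn; ring. Qed.

Let s2_le : s ^+ 2 <= sigma ^+ 2.
Proof. by rewrite s2 ler_piMl ?sqr_ge0// gerBl. Qed.

Let coord j w := theta0 j + sigma * xi j w.

Let mcoord j : measurable_fun setT (coord j).
Proof. by apply: measurable_funD => //; exact: measurable_funM. Qed.

Let Y w : k.-tuple R := truncation k (fun j => coord j w).

Let tnthY w i : tnth (Y w) i = coord i w.
Proof. by rewrite tnth_mktuple. Qed.

Lemma measurable_observation : measurable_fun setT Y.
Proof.
apply/measurable_fun_tnthP => i.
by rewrite (_ : _ \o _ = coord i)//; apply/funext => w /=; exact: tnthY.
Qed.

(** Independence identifies the law of [Y] with a product law, by agreement on rational boxes.
    Coordinatewise, a null set of N(0, M^2) is Lebesgue null, so is its preimage under x -> theta0 i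
    + sigma x, and N(0, 1) does not charge that preimage. *)
Lemma observation_null (N : set (k.-tuple R)) : measurable N ->
  gaussian (truncation k (fun=> 0)) M N = 0%E -> P (Y @^-1` N) = 0%E.
Proof.
move=> mN N0.
pose cmix j := isMeasurableFun.Build _ _ _ _ (coord j) (mcoord j).
pose cRV j : {RV P >-> R} := HB.pack (coord j) (cmix j).
pose ymix := isMeasurableFun.Build _ _ _ _ Y measurable_observation.
pose yRV : {mfun Omega >-> k.-tuple R} := HB.pack Y ymix.
have : prod_prob (fun i : 'I_k => distribution P (cRV i)) N = 0%E.
  apply: prod_prob_null mN N0 => i A mA; rewrite tnth_mktuple => A0.
  have mA' : measurable ((fun x => theta0 i + sigma * x) @^-1` A).
    rewrite -[X in measurable X]setTI.
    have mf : measurable_fun setT (fun x : R => theta0 i + sigma * x).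
      by apply: measurable_funD => //; exact: measurable_funM.
    exact: mf.
  transitivity (distribution P (xi i) ((fun x => theta0 i + sigma * x) @^-1` A)).
    by [].
  rewrite xi_normal//.
  have /null_content_dominatesP := normal_prob_dominates (0 : R) 1.
  apply => //; apply: lebesgue_null_affine => //.
  exact: (normal_null_lebesgue (m := 0) M_gt0).
move=> <-; transitivity (distribution P yRV N); first by [].
apply: (@boxes_unique _ R R k (@rational_rays R)) => //.
- exact: rational_raysT.
- exact: rational_rays_setI_closed.
- exact: measurable_rational_rays.
- by rewrite [X in (X < _)%E](_ : _ = 1%E) ?ltry//; exact: probability_setT.
move=> _ [E DE <-].
have mE i : measurable (E i).
  by rewrite measurable_rational_rays; apply: sub_sigma_algebra; exact: DE.
rewrite [RHS](prod_prob_box _ mE).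
(* Independence concerns families indexed by [nat]: the sides of the box are completed by [setT]
   from index [k] on, and [iota 0 k] selects the observed indices. *)
pose A j : set R := if insub j is Some i then E i else setT.
have AE (i : 'I_k) : A i = E i by rewrite /A valK.
have mA j : measurable (A j) by rewrite /A; case: insubP.
pose A' j := (fun x => theta0 j + sigma * x) @^-1` A j.
have mA' j : measurable (A' j).
  rewrite -[X in measurable X]setTI.
  have mf : measurable_fun setT (fun x : R => theta0 j + sigma * x).
    by apply: measurable_funD => //; exact: measurable_funM.
  exact: mf.
have := xi_indep (J := iota 0 k) (iota_uniq 0 k) mA'.
have -> : (\prod_(j <- iota 0 k) P (xi j @^-1` A' j) =
   \prod_(i < k) distribution P (cRV i) (E i))%E.
  rewrite -[in iota _ _](subn0 k) big_mkord; apply: eq_bigr => i _.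
  by rewrite /A' AE.
move=> <-; congr (P _).
apply/seteqP; split => w /=.
  move=> h j; rewrite /= mem_iota add0n => /andP[_ jk].
  have := h (Ordinal jk); rewrite -AE.
  by rewrite (tnthY w (Ordinal jk)).
move=> h i; have := h i; rewrite /= mem_iota/= add0n ltn_ord => /(_ isT).
by rewrite /A' /= AE (tnthY w i).
Qed.

Lemma observation_ae (Q : k.-tuple R -> Prop) :
  {ae gaussian (truncation k (fun=> 0)) M, forall y, Q y} ->
  {ae P, forall w, Q (Y w)}.
Proof.
move=> [N [mN N0 QN]]; exists (Y @^-1` N); split.
- by rewrite -[X in measurable X]setTI; exact: measurable_observation.
- exact: observation_null.
- by move=> w /= h; apply: QN.
Qed.

Let xi_sqr j : (\int[P]_w ((xi j w) ^+ 2)%:E <= 8%:E)%E.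
Proof.
have mX : measurable_fun setT (fun x : R => (x ^+ 2)%:E).
  by apply/measurable_EFinP; exact: measurable_funX.
have := normal_second_moment_le (0 : R) ltr01; rewrite expr1n mulr1.
apply: le_trans; rewrite -(@ge0_integral_distribution _ _ _ _ _ P (xi j) (fun x => (x ^+ 2)%:E))//; last first.
  by move=> x; rewrite lee_fin sqr_ge0.
rewrite le_eqVlt; apply/orP; left; apply/eqP.
rewrite (eq_measure_integral (normal_law 0 1)) => [|A mA _]; last first.
  exact: xi_normal.
by apply: eq_integral => x _; rewrite subr0.
Qed.

Let noise_sqr j : (\int[P]_w ((coord j w - theta0 j) ^+ 2)%:E <= (8 * sigma ^+ 2)%:E)%E.
Proof.
rewrite mulrC EFinM.
under eq_integral do rewrite /coord addrAC subrr add0r exprMn EFinM.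
rewrite ge0_integralZl//; last 3 first.
- by apply/measurable_EFinP; exact: measurable_funX.
- by move=> w _; rewrite lee_fin sqr_ge0.
- by rewrite lee_fin sqr_ge0.
by rewrite lee_wpmul2l ?lee_fin ?sqr_ge0.
Qed.

Let coord_sqr j :
  (\int[P]_w ((coord j w) ^+ 2)%:E <= (2 * theta0 j ^+ 2 + 16 * sigma ^+ 2)%:E)%E.
Proof.
have mn : measurable_fun setT (fun w => (coord j w - theta0 j) ^+ 2).
  by apply: measurable_funX; exact: measurable_funB.
apply: (@le_trans _ _ (\int[P]_w ((2 * theta0 j ^+ 2)%:E +
    2%:E * ((coord j w - theta0 j) ^+ 2)%:E))%E).
  apply: ge0_le_integral => //.
  - by move=> w _; rewrite lee_fin sqr_ge0.
  - by apply/measurable_EFinP; exact: measurable_funX.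
  - apply: emeasurable_funD => //; apply: emeasurable_funM => //.
    exact/measurable_EFinP.
  - move=> w _; rewrite -EFinM -EFinD lee_fin.
    by have := sqr_ge0 (coord j w - 2 * theta0 j); nra.
rewrite ge0_integralD//; last 3 first.
- by move=> w _; rewrite lee_fin mulr_ge0 ?sqr_ge0.
- by move=> w _; rewrite mule_ge0 ?lee_fin ?sqr_ge0.
- by apply: emeasurable_funM => //; exact/measurable_EFinP.
rewrite integral_prob_cst [leRHS]EFinD leeD2l// ge0_integralZl//; last 2 first.
- exact/measurable_EFinP.
- by move=> w _; rewrite lee_fin sqr_ge0.
apply: (le_trans (lee_wpmul2l _ (noise_sqr j))) => //.
by rewrite -EFinM lee_fin; lra.
Qed.

Variables (post : R.-pker k.-tuple R ~> k.-tuple R) (S : R).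
Hypothesis post_posterior :
  is_posterior (gaussian (truncation k (fun=> 0)) tau)
    (fun theta => gaussian theta sigma) post.
Hypothesis theta0_le : \sum_(i < k) theta0 i ^+ 2 <= S.

Let post_ae : {ae P, forall w, forall A, measurable A ->
  post (Y w) A = gaussian (scale_tuple (1 - e) (Y w)) s A}.
Proof.
apply: (@observation_ae (fun y => forall A, measurable A ->
  post y A = gaussian (scale_tuple (1 - e) y) s A)).
have := gaussian_posterior_ae sigma_gt0 tau_gt0 post_posterior.
by rewrite -/M shrinkE -/s.
Qed.

(** In Z, each coordinate contributes e^2 by itself and (e^2 / sigma^2) times a second moment
    bounded by 2 theta0^2 + 16 sigma^2; the noise part adds 16 e^2, whence 17. *)
Lemma integral_dTV_posterior_le delta : e ^+ 2 <= 2^-1 -> 0 < delta ->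
  (\int[P]_w dTV (post (Y w)) (gaussian (Y w) sigma) <=
   (delta + (2 / delta + 2) *
     (17 * k%:R * e ^+ 2 + 2 * S * (e ^+ 2 / sigma ^+ 2)))%:E)%E.
Proof.
move=> e2 d0.
have d1 : 0 <= 2 / delta + 2 by rewrite addr_ge0// divr_ge0// ltW.
have es0 : 0 <= e ^+ 2 / sigma ^+ 2 by rewrite divr_ge0 ?sqr_ge0.
pose h w := \sum_(i < k) (e ^+ 2 + e ^+ 2 / sigma ^+ 2 * coord i w ^+ 2).
have t0 (i : 'I_k) w : 0 <= e ^+ 2 + e ^+ 2 / sigma ^+ 2 * coord i w ^+ 2.
  by rewrite addr_ge0 ?sqr_ge0// mulr_ge0// sqr_ge0.
have mt (i : 'I_k) : measurable_fun setT
    (fun w => e ^+ 2 + e ^+ 2 / sigma ^+ 2 * coord i w ^+ 2).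
  apply: measurable_funD => //; apply: measurable_funM => //.
  exact: measurable_funX.
have h0 w : 0 <= h w by exact: sumr_ge0.
have mh : measurable_fun setT h by exact: measurable_sum.
apply: (@le_trans _ _ (\int[P]_w (delta%:E + (2 / delta + 2)%:E * (h w)%:E))%E).
  apply: ae_ge0_le_lower_integral.
  - by move=> w; apply: ereal_sup_ubound; exists set0 => //; rewrite !measure0 sube0 abse0.
  - by move=> w; rewrite adde_ge0 ?mule_ge0 ?lee_fin// ltW.
  - apply: emeasurable_funD => //; apply: emeasurable_funM => //.
    exact/measurable_EFinP.
  - apply: filterS post_ae => w hw.
    have -> : dTV (post (Y w)) (gaussian (Y w) sigma) =
        dTV (gaussian (scale_tuple (1 - e) (Y w)) s) (gaussian (Y w) sigma).
      rewrite /dTV; congr ereal_sup; apply/seteqP; split => _ [A mA <-];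
        by exists A => //; rewrite hw.
    apply: (le_trans (gaussian_shrink_dTV_le sigma_gt0 _ e_ge0 e2 s_gt0 s2 d0)).
    rewrite -EFinM -EFinD lee_fin lerD2l ler_wpM2l//.
    by apply: ler_sum => i _; rewrite tnthY.
rewrite ge0_integralD//; last 3 first.
- by move=> w _; rewrite lee_fin ltW.
- by move=> w _; rewrite mule_ge0 ?lee_fin.
- by apply: emeasurable_funM => //; exact/measurable_EFinP.
rewrite integral_prob_cst [leRHS]EFinD leeD2l// ge0_integralZl//; last 2 first.
- exact/measurable_EFinP.
- by move=> w _; rewrite lee_fin.
rewrite EFinM lee_wpmul2l ?lee_fin//.
rewrite /h; under eq_integral do rewrite -sumEFin.
rewrite ge0_integral_sum//; last 2 first.
- by move=> i; exact/measurable_EFinP.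
- by move=> i w _; rewrite lee_fin.
apply: (@le_trans _ _ (\sum_(i < k) (e ^+ 2 +
    e ^+ 2 / sigma ^+ 2 * (2 * theta0 i ^+ 2 + 16 * sigma ^+ 2))%:E)%E).
  apply: lee_sum => i _; under eq_integral do rewrite EFinD (EFinM (e ^+ 2 / _)).
  have mc : measurable_fun setT (fun w => ((coord i w) ^+ 2)%:E).
    by apply/measurable_EFinP; exact: measurable_funX.
  rewrite ge0_integralD//; last 3 first.
  - by move=> w _; rewrite lee_fin sqr_ge0.
  - by move=> w _; rewrite mule_ge0 ?lee_fin ?sqr_ge0.
  - exact: emeasurable_funM.
  rewrite integral_prob_cst [leRHS]EFinD leeD2l// ge0_integralZl//; last first.
    by move=> w _; rewrite lee_fin sqr_ge0.
  by rewrite (EFinM (e ^+ 2 / _)) lee_wpmul2l ?lee_fin.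
rewrite sumEFin lee_fin big_split/= sumr_const card_ord -mulr_sumr big_split/=.
rewrite -mulr_sumr sumr_const card_ord mulrDr.
have -> : e ^+ 2 / sigma ^+ 2 * (16 * sigma ^+ 2 *+ k) = 16 * k%:R * e ^+ 2.
  by rewrite -mulr_natr; field; rewrite gt_eqF.
rewrite -mulr_natr.
have := ler_wpM2l es0 theta0_le; nra.
Qed.

(** [T] stands for the squared norm of the centre beyond its first [k] entries, so that one bound
    serves both centres. The constant 48 is 16 + 32: twice 8 for the posterior spread, using s <=
    sigma, and four times 8 for the noise. *)
Lemma integral_posterior_tail_le (a T : R) : 0 < a -> 0 <= T ->
  (\int[P]_w post (Y w)
     [set theta | a ^+ 2 <= \sum_(i < k) (tnth theta i - theta0 i) ^+ 2 + T]%R <=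
   ((48 * k%:R * sigma ^+ 2 + 4 * e ^+ 2 * S + T) / a ^+ 2)%:E)%E.
Proof.
move=> a0 T0.
pose D (t : k.-tuple R) := \sum_(i < k) (tnth t i - theta0 i) ^+ 2.
have D0 t : 0 <= D t by apply: sumr_ge0 => i _; exact: sqr_ge0.
have mDi (i : 'I_k) : measurable_fun setT (fun t : k.-tuple R => (tnth t i - theta0 i) ^+ 2).
  by apply: measurable_funX; apply: measurable_funB => //; exact: measurable_tnth.
have mD : measurable_fun setT D by exact: measurable_sum.
set B := [set _ | _].
have mB : measurable B.
  rewrite -[B]setTI; apply: measurable_fun_le => //; exact: measurable_funD.
have a2 : 0 < a ^+ 2 by rewrite exprn_gt0.
pose h w := \sum_(i < k) (16 * sigma ^+ 2 + 4 * e ^+ 2 * theta0 i ^+ 2 +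
  4 * (coord i w - theta0 i) ^+ 2).
have t0 (i : 'I_k) w : 0 <= 16 * sigma ^+ 2 + 4 * e ^+ 2 * theta0 i ^+ 2 +
  4 * (coord i w - theta0 i) ^+ 2.
  apply: addr_ge0; last by rewrite mulr_ge0 ?sqr_ge0.
  apply: addr_ge0; first by rewrite mulr_ge0 ?sqr_ge0.
  by apply: mulr_ge0; [rewrite mulr_ge0 ?sqr_ge0|exact: sqr_ge0].
have mn (i : 'I_k) : measurable_fun setT (fun w => (coord i w - theta0 i) ^+ 2).
  by apply: measurable_funX; exact: measurable_funB.
have mt (i : 'I_k) : measurable_fun setT (fun w =>
    16 * sigma ^+ 2 + 4 * e ^+ 2 * theta0 i ^+ 2 + 4 * (coord i w - theta0 i) ^+ 2).
  by apply: measurable_funD => //; exact: measurable_funM.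
have h0 w : 0 <= h w by exact: sumr_ge0.
have mh : measurable_fun setT h by exact: measurable_sum.
(* Markov's inequality for the posterior N(c Y, s^2 I_k), c = 1 - e, using
   theta - theta0 = (theta - c Y) + c (Y - theta0) - e theta0. *)
have markov w : (gaussian (scale_tuple (1 - e) (Y w)) s B <= ((h w + T) / a ^+ 2)%:E)%E.
  set G := gaussian _ _.
  have GD : (\int[G]_t (D t)%:E <= (h w)%:E)%E.
    under eq_integral do rewrite /D -sumEFin.
    rewrite ge0_integral_sum//; last 2 first.
    - by move=> i; exact/measurable_EFinP.
    - by move=> i t _; rewrite lee_fin sqr_ge0.
    rewrite /h -sumEFin; apply: lee_sum => i _.
    have mX : measurable_fun setT (fun x : R => (x - theta0 i) ^+ 2).
      by apply: measurable_funX; exact: measurable_funB.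
    rewrite (@ge0_integral_tnth _ _ R k _ (fun x : R => (x - theta0 i) ^+ 2) i)//; last first.
      by move=> x; exact: sqr_ge0.
    rewrite tnth_mktuple tnthY; set c := (1 - e) * coord i w.
    have mc : measurable_fun setT (fun x : R => (x - c) ^+ 2).
      by apply: measurable_funX; exact: measurable_funB.
    apply: (@le_trans _ _ (\int[normal_law c s]_x (2%:E * ((x - c) ^+ 2)%:E +
        (2 * (c - theta0 i) ^+ 2)%:E))%E).
      apply: ge0_le_integral => //.
      - by move=> x _; rewrite lee_fin sqr_ge0.
      - exact/measurable_EFinP.
      - apply: emeasurable_funD => //; apply: emeasurable_funM => //.
        exact/measurable_EFinP.
      - move=> x _; rewrite -EFinM -EFinD lee_fin.
        by have := sqr_ge0 ((x - c) - (c - theta0 i)); nra.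
    rewrite ge0_integralD//; last 3 first.
    - by move=> x _; rewrite mule_ge0 ?lee_fin ?sqr_ge0.
    - by apply: emeasurable_funM => //; exact/measurable_EFinP.
    - by move=> x _; rewrite lee_fin mulr_ge0 ?sqr_ge0.
    rewrite integral_prob_cst ge0_integralZl//; last 2 first.
    - exact/measurable_EFinP.
    - by move=> x _; rewrite lee_fin sqr_ge0.
    apply: (@le_trans _ _ (2%:E * (8 * s ^+ 2)%:E + (2 * (c - theta0 i) ^+ 2)%:E)%E).
      by rewrite leeD2r// lee_wpmul2l//; exact: normal_second_moment_le.
    rewrite -EFinM -EFinD lee_fin.
    have -> : c - theta0 i = (1 - e) * (coord i w - theta0 i) - e * theta0 i.
      by rewrite /c; ring.
    set z := coord i w - theta0 i.
    have hz : ((1 - e) * z) ^+ 2 <= z ^+ 2.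
      by rewrite exprMn ler_piMl ?sqr_ge0// exprn_ile1// ?subr_ge0// gerBl.
    have := sqr_ge0 ((1 - e) * z + e * theta0 i); have := s2_le; nra.
  apply: (@le_trans _ _ (\int[G]_t ((a ^+ 2)^-1%:E * ((D t)%:E + T%:E)))%E).
    rewrite -(setIT B) -integral_indic//.
    apply: ge0_le_integral => //.
    - exact/measurable_EFinP.
    - apply: emeasurable_funM => //; apply: emeasurable_funD => //.
      exact/measurable_EFinP.
    - move=> t _; rewrite -EFinD -EFinM lee_fin indicE.
      have [|_] := boolP (t \in B); last first.
        by apply: mulr_ge0; [rewrite invr_ge0 ltW|exact: addr_ge0].
      rewrite inE /B /= -/(D t) => Bt.
      by rewrite mulrC ler_pdivlMr// mul1r.
  rewrite ge0_integralZl//; last 3 first.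
  - by apply: emeasurable_funD => //; exact/measurable_EFinP.
  - by move=> t _; rewrite adde_ge0 ?lee_fin.
  - by rewrite lee_fin invr_ge0 ltW.
  have -> : ((h w + T) / a ^+ 2)%:E = ((a ^+ 2)^-1%:E * (h w + T)%:E)%E.
    by rewrite -EFinM mulrC.
  rewrite lee_wpmul2l//; first by rewrite lee_fin invr_ge0 ltW.
  rewrite ge0_integralD//; last 2 first.
  - by move=> t _; rewrite lee_fin.
  - exact/measurable_EFinP.
  by rewrite integral_prob_cst [leRHS]EFinD leeD2r.
apply: (@le_trans _ _ (\int[P]_w ((a ^+ 2)^-1%:E * ((h w)%:E + T%:E)))%E).
  apply: ae_ge0_le_lower_integral => //.
  - by move=> w; rewrite mule_ge0 ?adde_ge0 ?lee_fin ?invr_ge0// ltW.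
  - apply: emeasurable_funM => //; apply: emeasurable_funD => //.
    exact/measurable_EFinP.
  - apply: filterS post_ae => w hw; rewrite hw//.
    by apply: (le_trans (markov w)); rewrite -EFinD -EFinM mulrC.
rewrite ge0_integralZl//; last 3 first.
- by apply: emeasurable_funD => //; exact/measurable_EFinP.
- by move=> w _; rewrite adde_ge0 ?lee_fin.
- by rewrite lee_fin invr_ge0 ltW.
rewrite [leRHS](_ : _ = ((a ^+ 2)^-1%:E *
    (48 * k%:R * sigma ^+ 2 + 4 * e ^+ 2 * S + T)%:E)%E); last first.
  by rewrite -EFinM mulrC.
rewrite lee_wpmul2l//; first by rewrite lee_fin invr_ge0 ltW.
rewrite ge0_integralD//; last 2 first.
- by move=> w _; rewrite lee_fin.
- exact/measurable_EFinP.
rewrite integral_prob_cst [leRHS]EFinD leeD2r//.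
rewrite /h; under eq_integral do rewrite -sumEFin.
rewrite ge0_integral_sum//; last 2 first.
- by move=> i; exact/measurable_EFinP.
- by move=> i w _; rewrite lee_fin.
apply: (@le_trans _ _ (\sum_(i < k) (48 * sigma ^+ 2 +
    4 * e ^+ 2 * theta0 i ^+ 2)%:E)%E).
  apply: lee_sum => i _; under eq_integral do rewrite EFinD (EFinM 4).
  rewrite ge0_integralD//; last 3 first.
  - move=> w _; rewrite lee_fin; apply: addr_ge0; first by rewrite mulr_ge0 ?sqr_ge0.
    by apply: mulr_ge0; [rewrite mulr_ge0 ?sqr_ge0|exact: sqr_ge0].
  - by move=> w _; rewrite mule_ge0 ?lee_fin ?sqr_ge0.
  - by apply: emeasurable_funM => //; exact/measurable_EFinP.
  rewrite integral_prob_cst ge0_integralZl//; last 2 first.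
  - exact/measurable_EFinP.
  - by move=> w _; rewrite lee_fin sqr_ge0.
  apply: (le_trans (leeD2l _ (lee_wpmul2l _ (noise_sqr i)))) => //.
  by rewrite -EFinM -EFinD lee_fin; lra.
rewrite sumEFin lee_fin big_split/= sumr_const card_ord -mulr_sumr.
rewrite -[X in X + _ <= _]mulr_natr.
have e40 : 0 <= 4 * e ^+ 2 by rewrite mulr_ge0 ?sqr_ge0.
have := ler_wpM2l e40 theta0_le; lra.
Qed.

End observations.

(** * Distances in l^2 and Sobolev tails *)

Section l2_distance.
Context (R : realType).
Implicit Types (u : nat -> R) (a T : R).

Lemma l2normE u : l2norm u = ((\sum_(j <oo) (u j ^+ 2)%:E) `^ 2^-1)%E.
Proof.
rewrite /l2norm Lnorm_counting//; congr (_ `^ _)%E.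
apply: eq_eseriesr => j _ /=.
by rewrite -[2]/(2%:R) powR_mulrn// real_normK// num_real.
Qed.

(** From index [k] on the completed vector [t] vanishes, so the tail of the series comes from [u]
    alone and does not depend on [t]: the event becomes a condition on finitely many coordinates. *)
Lemma le_l2dist k (t : k.-tuple R) u a T : 0 < a ->
  (\sum_(k <= j <oo) (u j ^+ 2)%:E)%E = T%:E ->
  (a%:E <= l2dist t u)%E = (a ^+ 2 <= \sum_(i < k) (tnth t i - u i) ^+ 2 + T).
Proof.
move=> a0 uT.
have T0 : 0 <= T.
  by rewrite -lee_fin -uT; apply: nneseries_ge0 => j _ _; rewrite lee_fin sqr_ge0.
rewrite /l2dist l2normE (nneseries_split 0 k); last first.
  by move=> j _; rewrite lee_fin sqr_ge0.
rewrite add0n [X in (_ + X)%E](_ : _ = T%:E); last first.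
  rewrite -uT; congr (limn _); apply/funext => n.
  apply: eq_big_nat => j /andP[kj _].
  by rewrite nth_default ?size_tuple// sub0r sqrrN.
rewrite big_mkord sumEFin -EFinD poweR_EFin lee_fin.
set X := _ + T; set Y := _ + T.
have -> : X = Y.
  by congr (_ + _); apply: eq_bigr => i _; rewrite (tnth_nth 0).
have Y0 : 0 <= Y by rewrite addr_ge0// sumr_ge0// => i _; exact: sqr_ge0.
have -> : (a ^+ 2 <= Y) = (a ^+ 2 <= Num.sqrt Y ^+ 2) by rewrite sqr_sqrtr.
by rewrite powR12_sqrt// ler_pXn2r// nnegrE ?sqrtr_ge0// ltW.
Qed.

Lemma truncation_tail k u :
  (\sum_(k <= j <oo) ((nth 0 (truncation k u) j) ^+ 2)%:E)%E = 0%E.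
Proof.
apply: eseries0 => j kj _.
by rewrite nth_default ?size_tuple// expr0n.
Qed.

Variables (alpha : R) (theta : nat -> R).
Hypotheses (alpha_gt0 : 0 < alpha) (sob : sobolev alpha theta).

Let w j := `|theta j| ^+ 2 * j.+1%:R `^ (2 * alpha).

Let w0 j : 0 <= w j.
Proof. by rewrite mulr_ge0 ?sqr_ge0// powR_ge0. Qed.

Let le_w j : theta j ^+ 2 <= w j.
Proof.
rewrite /w real_normK ?num_real// ler_peMr ?sqr_ge0//.
have {1}-> : 1 = 1 `^ (2 * alpha) :> R by rewrite powR1.
by apply: ge0_ler_powR; rewrite ?nnegrE ?mulr_ge0 ?ler1n// ltW.
Qed.

Definition sobolev_energy := limn (series w).

Let energyE : (\sum_(j <oo) (w j)%:E)%E = sobolev_energy%:E.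
Proof.
rewrite /sobolev_energy -EFin_lim//; congr (limn _); apply/funext => n /=.
by rewrite sumEFin.
Qed.

Lemma sum_sqr_le_sobolev_energy k : \sum_(i < k) theta i ^+ 2 <= sobolev_energy.
Proof.
rewrite -lee_fin -energyE.
apply: (@le_trans _ _ (\sum_(0 <= j < k) (w j)%:E)%E).
  by rewrite sumEFin big_mkord lee_fin; apply: ler_sum => i _.
by apply: nneseries_lim_ge => j _ _; rewrite lee_fin.
Qed.

Lemma sobolev_energy_ge0 : 0 <= sobolev_energy.
Proof. by apply: le_trans (sum_sqr_le_sobolev_energy 0); rewrite big_ord0. Qed.

(** From index [k] on, the Sobolev weights (j + 1)^(2 alpha) are at least k^(2 alpha). The tail is
    returned as a real [T] because it enters the finite-dimensional event as a number. *)
Lemma sobolev_tail k : (0 < k)%N -> exists T,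
  [/\ 0 <= T, (\sum_(k <= j <oo) (theta j ^+ 2)%:E)%E = T%:E &
      T <= (k%:R `^ (2 * alpha))^-1 * sobolev_energy].
Proof.
move=> k0; set c := (k%:R `^ (2 * alpha))^-1.
have kR : 0 < k%:R :> R by rewrite ltr0n.
have ka0 : 0 < k%:R `^ (2 * alpha) :> R by rewrite powR_gt0.
have c0 : 0 <= c by rewrite invr_ge0 ltW.
have tail_le : (\sum_(k <= j <oo) (theta j ^+ 2)%:E <= (c * sobolev_energy)%:E)%E.
  rewrite -nneseries_addn; last by move=> j; rewrite lee_fin sqr_ge0.
  apply: (@le_trans _ _ (\sum_(j <oo) (c%:E * (w (j + k)%N)%:E))%E).
    apply: lee_nneseries => [j _ _|j _]; first by rewrite lee_fin sqr_ge0.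
    rewrite -EFinM lee_fin /w real_normK ?num_real// mulrCA.
    rewrite ler_peMr ?sqr_ge0// /c mulrC ler_pdivlMr// mul1r.
    apply: ge0_ler_powR; rewrite ?nnegrE ?mulr_ge0// ?ltW//.
    by rewrite ltr_nat ltnS leq_addl.
  rewrite nneseriesZl; last by move=> j _; rewrite lee_fin.
  rewrite EFinM lee_wpmul2l ?lee_fin//.
  rewrite (@nneseries_addn _ (fun j => (w j)%:E) k); last by move=> j; rewrite lee_fin.
  rewrite -energyE (nneseries_split 0 k); last by move=> j _; rewrite lee_fin.
  by rewrite add0n leeDr// sume_ge0// => j _; rewrite lee_fin.
have tail0 : (0 <= \sum_(k <= j <oo) (theta j ^+ 2)%:E)%E.
  by apply: nneseries_ge0 => j _ _; rewrite lee_fin sqr_ge0.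
have tf : (\sum_(k <= j <oo) (theta j ^+ 2)%:E)%E \is a fin_num.
  by rewrite ge0_fin_numE// (le_lt_trans tail_le)// ltry.
exists (fine (\sum_(k <= j <oo) (theta j ^+ 2)%:E)%E); split.
- exact: fine_ge0.
- by rewrite fineK.
- by rewrite -lee_fin fineK.
Qed.

End l2_distance.

(** * Asymptotics of the shrinkage factor and of the rate *)

Section limits.
Context (R : realType).

(** The bound with eps = 1 makes the extended values eventually finite, which reduces the limit to
    real numbers. *)
Lemma cvge0_squeeze (F : nat -> \bar R) : (forall n, 0 <= F n)%E ->
  (forall eps : R, 0 < eps -> \forall n \near \oo, (F n <= eps%:E)%E) ->
  F @ \oo --> 0%E.
Proof.
move=> F0 Feps.
have Ffin eps n : (F n <= eps%:E)%E -> F n \is a fin_num.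
  by move=> h; rewrite ge0_fin_numE// (le_lt_trans h)// ltry.
apply/fine_cvgP; split.
  by apply: filterS (Feps 1 ltr01) => n; exact: Ffin.
apply/cvgrPdist_le => eps eps0; apply: filterS (Feps _ eps0) => n Fn.
have f := Ffin _ _ Fn.
by rewrite sub0r normrN ger0_norm ?fine_ge0// -lee_fin fineK.
Qed.

Lemma shrinkage_cvg0 (tau : nat -> R) :
  (forall n, (0 < n)%N -> 0 < tau n) ->
  (fun n : nat => n%:R `^ (- 4^-1) : R^o) =o_\oo (tau : nat -> R^o) ->
  forall eta : R, 0 < eta -> \forall n \near \oo,
    n%:R * ((Num.sqrt n%:R)^-1 ^+ 2 /
      Num.sqrt ((Num.sqrt n%:R)^-1 ^+ 2 + tau n ^+ 2) ^+ 2) ^+ 2 <= eta.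
Proof.
move=> tau0 /eqoP tauo eta eta0.
(* From n^(-1/4) <= b tau one gets 1 / n <= b^4 tau^4, so the quantity is at most b^4; the cap at 1
   then gives b^4 <= b <= eta. *)
pose b := Num.min 1 eta.
have b0 : 0 < b by rewrite lt_min ltr01.
have b1 : b <= 1 by rewrite ge_min lexx.
have beta : b <= eta by rewrite ge_min lexx orbT.
near=> n.
have n0 : (0 < n)%N by near: n; exists 1%N.
have nR : 0 < n%:R :> R by rewrite ltr0n.
have t0 := tau0 _ n0.
have nt : n%:R `^ (- 4^-1) <= b * tau n.
  have : `|n%:R `^ (- 4^-1) : R^o| <= b * `|tau n : R^o| by near: n; exact: tauo.
  by rewrite [X in X <= _]ger0_norm ?powR_ge0// [`|tau n : R^o|]gtr0_norm.
have n4 : n%:R^-1 <= b ^+ 4 * tau n ^+ 4.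
  have -> : n%:R^-1 = (n%:R `^ (- 4^-1)) ^+ 4 :> R.
    rewrite -powR_mulrn ?powR_ge0// -powRrM mulNr mulVf ?pnatr_eq0//.
    by rewrite powR_inv1// ltW.
  by rewrite -exprMn ler_pXn2r// nnegrE ?powR_ge0// mulr_ge0// ltW.
rewrite exprVn [Num.sqrt n%:R ^+ 2]sqr_sqrtr ?(ltW nR)//.
rewrite sqr_sqrtr; last first.
  by rewrite addr_ge0 ?sqr_ge0// invr_ge0 ltW.
set z := n%:R^-1.
have z0 : 0 < z by rewrite invr_gt0.
have t2 : 0 < tau n ^+ 2 by rewrite exprn_gt0.
have t4 : 0 < tau n ^+ 4 by rewrite exprn_gt0.
apply: le_trans beta.
apply: (@le_trans _ _ (b ^+ 4)); last first.
  by rewrite exprS ler_piMr ?(ltW b0)// exprn_ile1 ?(ltW b0).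
have -> : n%:R = z^-1 by rewrite /z invrK.
rewrite expr_div_n mulrA expr2 mulrA mulVf ?gt_eqF// mul1r.
rewrite ler_pdivrMr ?exprn_gt0 ?addr_gt0//.
apply: (le_trans n4); rewrite ler_pM2l ?exprn_gt0//.
have -> : tau n ^+ 4 = (tau n ^+ 2) ^+ 2 by rewrite -exprM.
by apply: lerXn2r; rewrite ?nnegrE ?lerDr ?addr_ge0 ?(ltW t2) ?(ltW z0).
Unshelve. all: by end_near. Qed.

(* With rate = n^(-a / (1 + 2a)), the condition k ~ n^(1 / (1 + 2a)) makes both
   the variance term k / n and the squared bias k^(-2a) of order rate^2. *)
Lemma sqr_rate_bounds (alpha c C : R) (n k : nat) : 0 < alpha -> 0 < c ->
  (0 < n)%N ->
  c <= k%:R / n%:R `^ (1 + 2 * alpha)^-1 <= C ->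
  let rate : R := n%:R `^ (- (alpha / (1 + 2 * alpha))) in
  [/\ 0 < rate, k%:R / n%:R <= C * rate ^+ 2 &
      (k%:R `^ (2 * alpha))^-1 <= (c `^ (2 * alpha))^-1 * rate ^+ 2].
Proof.
move=> a0 c0 n0 /andP[ck kC] rate.
have nR : 0 < n%:R :> R by rewrite ltr0n.
have d0 : 0 < 1 + 2 * alpha by rewrite addr_gt0// mulr_gt0.
set b := (1 + 2 * alpha)^-1 in ck kC *.
have nb : 0 < n%:R `^ b :> R by rewrite powR_gt0.
have rate2 : rate ^+ 2 = n%:R `^ (- (2 * alpha * b)).
  rewrite /rate -powR_mulrn ?powR_ge0// -powRrM; congr (_ `^ _).
  by rewrite /b; field; rewrite gt_eqF.
have kc : c * n%:R `^ b <= k%:R by rewrite -ler_pdivlMr.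
split; first exact: powR_gt0.
(* The exponents match because - 2 alpha b = b - 1. *)
- have -> : rate ^+ 2 = n%:R `^ b / n%:R.
    rewrite rate2 -[X in _ = _ / X]powRr1 ?ltW// -powRN -powRD; last first.
      by rewrite (gt_eqF nR) implybT.
    by congr (_ `^ _); rewrite /b; field; rewrite gt_eqF.
  by rewrite mulrA ler_pM2r ?invr_gt0// -ler_pdivrMr.
- have cn0 : 0 < (c * n%:R `^ b) `^ (2 * alpha) by rewrite powR_gt0// mulr_gt0.
  apply: (@le_trans _ _ ((c * n%:R `^ b) `^ (2 * alpha))^-1).
    rewrite lef_pV2 ?posrE//; last first.
      by rewrite powR_gt0// (lt_le_trans _ kc)// mulr_gt0.
    apply: ge0_ler_powR => //.
    - by rewrite mulr_ge0// ltW.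
    - by rewrite nnegrE mulr_ge0 ?(ltW c0) ?(ltW nb).
    - by rewrite nnegrE.
  by rewrite powRM ?(ltW c0) ?(ltW nb)// invfM rate2 powRN -powRrM [b * _]mulrC.
Qed.

End limits.

Theorem proposition2 (R : realType) (d : measure_display)
    (Omega : measurableType d) (P : probability Omega R)
    (xi : nat -> {RV P >-> R})
    (xi_normal : forall j (A : set R), measurable A ->
      distribution P (xi j) A = normal_prob 0 1 A)
    (xi_indep : mutually_independent xi)
    (alpha : R) (alpha_gt0 : 0 < alpha)
    (theta0 : nat -> R) (theta0_sobolev : sobolev alpha theta0)
    (k : nat -> nat) (k_bounds : forall n, (0 < n)%N -> (1 <= k n <= n)%N)
    (tau : nat -> R) (tau_gt0 : forall n, (0 < n)%N -> 0 < tau n)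
    (tau_large : (fun n : nat => n%:R `^ (- 4^-1) : R^o) =o_\oo
                 (tau : nat -> R^o))
    (post : forall n, R.-pker (k n).-tuple R ~> (k n).-tuple R)
    (post_posterior : forall n, (0 < n)%N ->
      is_posterior (gaussian (truncation (k n) (fun=> 0)) (tau n))
                   (fun theta => gaussian theta (Num.sqrt n%:R)^-1)
                   (post n)) :
  let Y n w := obs n (k n) theta0 (xi ^~ w) in
  let rate n : R := n%:R `^ (- (alpha / (1 + 2 * alpha))) in
  (fun n => \int[P]_w dTV (post n (Y n w))
                         (gaussian (Y n w) (Num.sqrt n%:R)^-1))%E
    @ \oo --> 0%E
  /\
  (same_order (fun n => (k n)%:R) (fun n => n%:R `^ (1 + 2 * alpha)^-1 : R) ->
   forall lambda : nat -> R, lambda @ \oo --> +oo ->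
     (fun n => \int[P]_w post n (Y n w)
        [set theta | ((lambda n * rate n)%:E <=
           l2dist theta (nth 0%R (truncation (k n) theta0)))%E])%E
       @ \oo --> 0%E
     /\
     (fun n => \int[P]_w post n (Y n w)
        [set theta | ((lambda n * rate n)%:E <= l2dist theta theta0)%E])%E
       @ \oo --> 0%E).
Proof.
move=> Y rate.
pose S := sobolev_energy alpha theta0.
have S0 : 0 <= S := sobolev_energy_ge0 alpha_gt0 theta0_sobolev.
pose sg n : R := (Num.sqrt n%:R)^-1.
pose e n := sg n ^+ 2 / Num.sqrt (sg n ^+ 2 + tau n ^+ 2) ^+ 2.
have sg0 n : (0 < n)%N -> 0 < sg n.
  by move=> n0; rewrite invr_gt0 sqrtr_gt0 ltr0n.
have sg2 n : sg n ^+ 2 = n%:R^-1 by rewrite /sg exprVn sqr_sqrtr.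
have ne_cvg0 : forall eta, 0 < eta -> \forall n \near \oo, n%:R * e n ^+ 2 <= eta.
  exact: shrinkage_cvg0.
have e2_le n : (0 < n)%N -> e n ^+ 2 <= n%:R * e n ^+ 2.
  by move=> n0; rewrite ler_peMl ?sqr_ge0// ler1n.
have kn n : (0 < n)%N -> (k n)%:R <= n%:R :> R.
  by move=> n0; rewrite ler_nat; case/andP: (k_bounds _ n0).
split.
  apply: cvge0_squeeze => [n|eps eps0].
    apply: integral_ge0 => w _; apply: ereal_sup_ubound.
    by exists set0 => //; rewrite !measure0 sube0 abse0.
  pose delta := eps / 2.
  have d0 : 0 < delta by rewrite divr_gt0.
  (* [A] is the coefficient of n e^2 in the bound, once k <= n and 1 / sigma^2 = n are used. *)
  pose A := (2 / delta + 2) * (17 + 2 * S).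
  have A0 : 0 < A.
    apply: mulr_gt0; first by rewrite ltr_wpDl// divr_ge0// ltW.
    by rewrite ltr_wpDr// mulr_ge0.
  (* The first bound ensures e^2 <= 1/2, as the chi-square estimate requires; the second makes the
     term linear in n e^2 at most delta, half of eps. *)
  pose eta := Num.min 2^-1 (delta / A).
  have eta0 : 0 < eta by rewrite lt_min invr_gt0 ltr0n divr_gt0.
  have eta1 : eta <= 2^-1 by rewrite ge_min lexx.
  have eta2 : eta <= delta / A by rewrite ge_min lexx orbT.
  near=> n.
  have n0 : (0 < n)%N by near: n; exists 1%N.
  have ne : n%:R * e n ^+ 2 <= eta by near: n; exact: ne_cvg0.
  have e2 : e n ^+ 2 <= 2^-1 := le_trans (e2_le _ n0) (le_trans ne eta1).
  apply: (le_trans (integral_dTV_posterior_le xi_normal xi_indep (sg0 _ n0)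
    (tau_gt0 _ n0) (post_posterior _ n0)
    (sum_sqr_le_sobolev_energy alpha_gt0 theta0_sobolev (k n)) e2 d0)).
  rewrite lee_fin -/S -/(e n) -/(sg n) sg2 invrK.
  have d2 : 0 <= 2 / delta + 2 by rewrite addr_ge0// divr_ge0// ltW.
  apply: (@le_trans _ _ (delta + A * eta)); last first.
    apply: (@le_trans _ _ (delta + delta)); last by rewrite /delta; lra.
    by rewrite lerD2l mulrC -ler_pdivlMr.
  have -> : A * eta = (2 / delta + 2) * (17 * eta + 2 * S * eta).
    by rewrite /A; ring.
  rewrite lerD2l ler_wpM2l//.
  apply: lerD.
    rewrite -mulrA ler_wpM2l//; apply: le_trans ne.
    by rewrite ler_wpM2r ?sqr_ge0 ?kn.
  by rewrite ler_wpM2l ?mulr_ge0// mulrC.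
move=> [c [C [c0 C0 kcC]]] lambda lambda_oo.
(* In units of rate^2: 48 C bounds the variance, 4 S C the shrinkage bias, and the last term the
   truncation bias. *)
pose K := (48 + 4 * S) * C + (c `^ (2 * alpha))^-1 * S.
have ca0 : 0 <= (c `^ (2 * alpha))^-1 by rewrite invr_ge0 powR_ge0.
have K0 : 0 <= K by rewrite addr_ge0 ?mulr_ge0 ?addr_ge0 ?mulr_ge0 ?(ltW C0).
(* Both centres share the first [k n] entries and differ only in their tails, zero for the
   truncation and a Sobolev tail for the full parameter. *)
have concentration (u : nat -> nat -> R) :
    (forall n (i : 'I_(k n)), u n i = theta0 i) ->
    (forall n, (0 < n)%N -> exists T,
      [/\ 0 <= T, (\sum_(k n <= j <oo) (u n j ^+ 2)%:E)%E = T%:E &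
          T <= ((k n)%:R `^ (2 * alpha))^-1 * S]) ->
    (fun n => \int[P]_w post n (Y n w)
        [set theta | ((lambda n * rate n)%:E <= l2dist theta (u n))%E])%E
       @ \oo --> 0%E.
  move=> utheta utail; apply: cvge0_squeeze => [n|eps eps0].
    by apply: integral_ge0.
  near=> n.
  have n0 : (0 < n)%N by near: n; exists 1%N.
  have nR : 0 < n%:R :> R by rewrite ltr0n.
  have ne : n%:R * e n ^+ 2 <= 1 by near: n; exact: ne_cvg0.
  (* With lambda >= 1 one has lambda <= lambda^2, so lambda >= K / eps already yields K <= eps
     lambda^2. *)
  have lam1 : 1 <= lambda n by near: n; move/cvgryPge : lambda_oo; apply.
  have lamK : K / eps <= lambda n by near: n; move/cvgryPge : lambda_oo; apply.
  have l0 : 0 < lambda n := lt_le_trans ltr01 lam1.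
  have [r0 kr kar] := sqr_rate_bounds alpha_gt0 c0 n0 (kcC _ n0).
  have [T [T0 uT TS]] := utail _ n0.
  have a0 : 0 < lambda n * rate n by rewrite mulr_gt0.
  rewrite (_ : [set theta | _] = [set theta | (lambda n * rate n) ^+ 2 <=
      \sum_(i < k n) (tnth theta i - theta0 i) ^+ 2 + T]%R); last first.
    apply/funext => t; apply/propext; rewrite /= (le_l2dist _ a0 uT).
    rewrite (eq_bigr (fun i => (tnth t i - theta0 i) ^+ 2)) => [//|i _].
    by rewrite utheta.
  apply: (le_trans (integral_posterior_tail_le xi_normal xi_indep (sg0 _ n0)
    (tau_gt0 _ n0) (post_posterior _ n0)
    (sum_sqr_le_sobolev_energy alpha_gt0 theta0_sobolev (k n)) a0 T0)).
  rewrite lee_fin -/S -/(e n) -/(sg n) sg2.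
  (* Only n e^2 <= 1 is used here; k >= 1 turns it into e^2 <= k / n, which brings the shrinkage
     bias to the order of the variance. *)
  have e2n : e n ^+ 2 <= n%:R^-1 by rewrite -(ler_pM2l nR) divff// gt_eqF.
  have k1 : 1 <= (k n)%:R :> R by rewrite ler1n; case/andP: (k_bounds _ n0).
  have e2k : e n ^+ 2 <= (k n)%:R / n%:R.
    by apply: (le_trans e2n); rewrite ler_peMl// invr_ge0 ltW.
  have num_le : 48 * (k n)%:R / n%:R + 4 * e n ^+ 2 * S + T <= K * rate n ^+ 2.
    have h1 : 4 * e n ^+ 2 * S <= 4 * S * (C * rate n ^+ 2).
      have -> : 4 * e n ^+ 2 * S = 4 * S * e n ^+ 2 by ring.
      apply: ler_wpM2l; first by rewrite mulr_ge0.
      exact: le_trans e2k kr.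
    have h2 : T <= (c `^ (2 * alpha))^-1 * rate n ^+ 2 * S.
      by apply: (le_trans TS); rewrite ler_wpM2r.
    rewrite (_ : K * _ = 48 * (C * rate n ^+ 2) + 4 * S * (C * rate n ^+ 2) +
        (c `^ (2 * alpha))^-1 * rate n ^+ 2 * S); last by rewrite /K; ring.
    by rewrite -[48 * _ / _]mulrA; apply: lerD => //; apply: lerD => //; rewrite ler_wpM2l.
  rewrite ler_pdivrMr ?exprn_gt0//; apply: (le_trans num_le).
  have -> : eps * (lambda n * rate n) ^+ 2 = eps * lambda n ^+ 2 * rate n ^+ 2.
    by rewrite exprMn mulrA.
  apply: ler_wpM2r; first exact: sqr_ge0.
  rewrite ler_pdivrMr// in lamK; apply: (le_trans lamK).
  by rewrite mulrC ler_wpM2l ?(ltW eps0)// ler_eXnr.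
split.
  apply: (concentration (fun n => nth 0 (truncation (k n) theta0))) => [n i|n n0].
    by rewrite -tnth_nth tnth_mktuple.
  exists 0; split => //; first exact: truncation_tail.
  by rewrite mulr_ge0// invr_ge0 powR_ge0.
apply: (concentration (fun=> theta0)) => // n n0.
by apply: sobolev_tail => //; case/andP: (k_bounds _ n0).
Unshelve. all: by end_near. Qed.
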